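(* Let $G$ be a Fitting-regular profinite group. Then $C_G(F^*(G)) = Z(F(G))$.
   Context: Conventions: all groups are profinite groups, subgroups are closed, homomorphisms are continuous, and generation means topological generation. A profinite group $Q$ is quasisimple if $Q$ is perfect and $Q/Z(Q)$ is (non-trivial) simple. A component of a profinite group $G$ is a subnormal subgroup that is quasisimple. The layer $E(G)$ is the subgroup generated by all components of $G$. The pro-Fitting subgroup $F(G)$ is the subgroup generated by all subnormal pro-$p$ subgroups of $G$, over all primes $p$. The generalised pro-Fitting subgroup is $F^*(G) = \langle E(G), F(G)\rangle$. A profinite group $G$ is Fitting-degenerate if $F^*(G)=1$, and Fitting-regular if no non-trivial image (quotient by a closed normal subgroup) of $G$ is Fitting-degenerate. $Z(\cdot)$ denotes the centre and $C_G(\cdot)$ the centraliser in $G$. *)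

(* Defs.v *)
From HB Require Import structures.
From mathcomp Require Import all_boot.
From mathcomp Require Import boolp classical_sets functions cardinality.
From mathcomp Require Import topology.

Set Implicit Arguments.
Unset Strict Implicit.
Unset Printing Implicit Defensive.

Local Open Scope classical_set_scope.
Local Open Scope card_scope.
Local Open Scope quotient_scope.
Local Open Scope group_scope.

HB.mixin Record isTopologicalGroup G of Group G & Topological G := {
  mulg_continuous_subproof : continuous (fun x : G * G => x.1 * x.2);
  invg_continuous_subproof : continuous (fun x : G => x^-1)
}.

#[short(type="topGroupType")]
HB.structure Definition TopGroup :=
  {G of Group G & Topological G & isTopologicalGroup G}.

Lemma mulg_continuous (G : topGroupType) :
  continuous (fun x : G * G => x.1 * x.2).
Proof. exact: mulg_continuous_subproof. Qed.

Lemma invg_continuous (G : topGroupType) : continuous (fun x : G => x^-1).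
Proof. exact: invg_continuous_subproof. Qed.

Definition profinite (G : topGroupType) : Prop :=
  [/\ compact [set: G], hausdorff_space G & totally_disconnected [set: G]].

(* Subgroups are abstract subgroups here; closedness is stated explicitly
   wherever it is required. *)
Record subgroup (G : groupType) := Subgroup {
  sgset :> set G;
  subgroup_closed : group_closed [in sgset]
}.

Record normal_subgroup (G : groupType) := NormalSubgroup {
  nsgroup :> subgroup G;
  normal_subgroupJ : forall x g : G, sgset nsgroup x -> sgset nsgroup (x ^ g)
}.

Section SubgroupFacts.
Context {G : groupType} (H : subgroup G).

Lemma subgroup1 : sgset H 1.
Proof. by have [/set_mem] := subgroup_closed H. Qed.

Lemma subgroupV x : sgset H x -> sgset H x^-1.
Proof.
move=> Hx; apply: set_mem; apply: (group_closedV (subgroup_closed H)).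
exact: mem_set.
Qed.

Lemma subgroupM x y : sgset H x -> sgset H y -> sgset H (x * y).
Proof.
move=> Hx Hy; apply: set_mem; apply: (group_closedM (subgroup_closed H));
  exact: mem_set.
Qed.

End SubgroupFacts.

Lemma topgroup_cvgM (T : topologicalType) (G : topGroupType) (f g : T -> G) :
  continuous f -> continuous g -> continuous (fun x => f x * g x).
Proof.
move=> cf cg x.
apply: (@continuous2_cvg _ _ _ _ _ _ f g (fun a b : G => a * b));
  [refine (@mulg_continuous G (f x, g x))|exact: cf | exact: cg].
Qed.

(* A subgroup as a topological group, with the subspace topology. *)
Definition subg (G : topGroupType) (H : subgroup G) : Type := set_type (sgset H).

Section Subg.
Context {G : topGroupType} (H : subgroup G).

HB.instance Definition _ := SubChoice.on (subg H).
HB.instance Definition _ :=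
  SubChoice_isSubGroup.Build G _ (subg H) (subgroup_closed H).
HB.instance Definition _ := Topological.copy (subg H) (set_type (sgset H)).

Lemma subg_val_continuous : continuous (val : subg H -> G).
Proof.
have -> : (val : subg H -> G) = set_val by rewrite set_valE.
exact: initial_continuous.
Qed.

Lemma continuous_to_subg (T : topologicalType) (f : T -> subg H) :
  continuous (val \o f) -> continuous f.
Proof.
move=> cf; apply: (@continuous_comp_initial (subg H) T G set_val f).
by rewrite set_valE.
Qed.

Lemma subg_mulg_continuous : continuous (fun x : subg H * subg H => x.1 * x.2).
Proof.
apply: continuous_to_subg.
have -> : val \o (fun x : subg H * subg H => x.1 * x.2) =
          (fun x => val x.1 * val x.2) by [].
apply: topgroup_cvgM => x; apply: continuous_comp.
- exact: cvg_fst.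
- exact: subg_val_continuous.
- exact: cvg_snd.
- exact: subg_val_continuous.
Qed.

Lemma subg_invg_continuous : continuous (fun x : subg H => x^-1).
Proof.
apply: continuous_to_subg.
have -> : val \o (fun x : subg H => x^-1) = (fun x => (val x)^-1) by [].
move=> x; apply: continuous_comp; first exact: subg_val_continuous.
exact: invg_continuous.
Qed.

HB.instance Definition _ :=
  isTopologicalGroup.Build (subg H) subg_mulg_continuous subg_invg_continuous.

End Subg.

(* The quotient group G / N, with the quotient topology. *)
Section CosetRel.
Context {G : groupType} (N : normal_subgroup G).

Definition coset_rel (x y : G) : bool := (x^-1 * y) \in sgset N.

Lemma coset_rel_refl : reflexive coset_rel.
Proof. by move=> x; rewrite /coset_rel mulVg; apply/mem_set/subgroup1. Qed.

Lemma coset_rel_impl x y : coset_rel x y -> coset_rel y x.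
Proof.
move=> /set_mem /subgroupV; rewrite invgM invgK => h; exact: mem_set.
Qed.

Lemma coset_rel_sym : symmetric coset_rel.
Proof. by move=> x y; apply/idP/idP; exact: coset_rel_impl. Qed.

Lemma coset_rel_trans : transitive coset_rel.
Proof.
move=> y x z /set_mem xy /set_mem yz; apply: mem_set.
by have := subgroupM xy yz; rewrite mulgA mulgK.
Qed.

Canonical coset_equiv :=
  EquivRel coset_rel coset_rel_refl coset_rel_sym coset_rel_trans.

End CosetRel.

Definition quotg (G : topGroupType) (N : normal_subgroup G) : Type :=
  quotient_topology {eq_quot (coset_equiv N)}.

Section Quotg.
Context {G : topGroupType} (N : normal_subgroup G).
Local Notation Q := (quotg N).

HB.instance Definition _ := Topological.on Q.
HB.instance Definition _ := Quotient.on Q.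

Lemma quotg_eqP (x y : G) : \pi_Q x = \pi_Q y <-> sgset N (x^-1 * y).
Proof.
split=> [/eqmodP/set_mem //|h]; apply/eqmodP; exact: mem_set.
Qed.

Definition quotg_one : Q := \pi_Q 1.
Definition quotg_mul (a b : Q) : Q := \pi_Q (repr a * repr b).
Definition quotg_inv (a : Q) : Q := \pi_Q (repr a)^-1.

Lemma quotg_piM (x y : G) : quotg_mul (\pi_Q x) (\pi_Q y) = \pi_Q (x * y).
Proof.
apply/quotg_eqP; rewrite invgM.
have hx : sgset N ((repr (\pi_Q x))^-1 * x) by apply/quotg_eqP; rewrite reprK.
have hy : sgset N ((repr (\pi_Q y))^-1 * y) by apply/quotg_eqP; rewrite reprK.
have := subgroupM hy (normal_subgroupJ y hx).
by rewrite /conjg !mulgA mulgK.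
Qed.

Lemma quotg_piV (x : G) : quotg_inv (\pi_Q x) = \pi_Q x^-1.
Proof.
apply/quotg_eqP; rewrite invgK.
have hx : sgset N ((repr (\pi_Q x))^-1 * x) by apply/quotg_eqP; rewrite reprK.
have := normal_subgroupJ x^-1 (subgroupV hx).
by rewrite /conjg invgM !invgK !mulgA mulgV mul1g.
Qed.

Lemma quotg_mulA : associative quotg_mul.
Proof.
move=> a b c; rewrite -[a]reprK -[b]reprK -[c]reprK.
by rewrite (quotg_piM (repr b)) (quotg_piM _ (repr b)) !quotg_piM mulgA.
Qed.

Lemma quotg_mul1 : left_id quotg_one quotg_mul.
Proof. by move=> a; rewrite -[a]reprK quotg_piM mul1g. Qed.

Lemma quotg_mulr1 : right_id quotg_one quotg_mul.
Proof. by move=> a; rewrite -[a]reprK quotg_piM mulg1. Qed.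

Lemma quotg_mulV : left_inverse quotg_one quotg_inv quotg_mul.
Proof. by move=> a; rewrite -[a]reprK quotg_piV quotg_piM mulVg. Qed.

Lemma quotg_mulrV : right_inverse quotg_one quotg_inv quotg_mul.
Proof. by move=> a; rewrite -[a]reprK quotg_piV quotg_piM mulgV. Qed.

HB.instance Definition _ :=
  isGroup.Build Q quotg_mulA quotg_mul1 quotg_mulr1 quotg_mulV quotg_mulrV.

Lemma piM (x y : G) : \pi_Q (x * y) = \pi_Q x * \pi_Q y.
Proof. by rewrite -quotg_piM. Qed.

Lemma piV (x : G) : \pi_Q x^-1 = (\pi_Q x)^-1.
Proof. by rewrite -quotg_piV. Qed.

Lemma quotg_pi_continuous : continuous (\pi_Q : G -> Q).
Proof. exact: pi_continuous. Qed.

Lemma quotg_pi_open (U : set G) : open U -> open (\pi_Q @` U).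
Proof.
move=> oU; rewrite /open/= /quotient_open.
have -> : \pi_Q @^-1` (\pi_Q @` U) =
          \bigcup_(n in sgset N) [set x | U (x * n)].
  apply/seteqP; split=> [x [u Uu /esym/quotg_eqP h]|x [n Nn Uxn]].
    by exists (x^-1 * u) => //=; rewrite mulgA mulgV mul1g.
  exists (x * n) => //; apply/esym/quotg_eqP.
  by rewrite mulgA mulVg mul1g.
apply: bigcup_open => n _.
suff /continuousP cn : continuous (fun x : G => x * n) by exact: cn.
by apply: topgroup_cvgM => x; [exact: cvg_id | exact: cvg_cst].
Qed.

Lemma quotg_mulg_continuous : continuous (fun x : Q * Q => x.1 * x.2).
Proof.
move=> [a b] W /=; rewrite -[a]reprK -[b]reprK.
set x := repr a; set y := repr b; rewrite -piM => nW.
have := @mulg_continuous G (x, y) _ (quotg_pi_continuous nW).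
move=> [[U V] /= [nU nV] UVW].
rewrite nbhsE in nU; rewrite nbhsE in nV.
move: nU nV => [U' [oU U'x] sU] [V' [oV V'y] sV].
exists (\pi_Q @` U', \pi_Q @` V') => /=.
  by split; apply: open_nbhs_nbhs; split;
    [exact: quotg_pi_open|exists x|exact: quotg_pi_open|exists y].
move=> [_ _] [/= [u U'u <-] [v V'v <-]]; rewrite -piM.
by apply: (UVW (u, v)); split; [exact: sU|exact: sV].
Qed.

Lemma quotg_invg_continuous : continuous (fun x : Q => x^-1).
Proof.
apply/quotient_continuous => x.
have -> : (fun x : Q => x^-1) \o \pi_Q = \pi_Q \o (fun x : G => x^-1).
  by apply/funext => z /=; rewrite piV.
apply: continuous_comp; [exact: invg_continuous|exact: quotg_pi_continuous].
Qed.

HB.instance Definition _ :=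
  isTopologicalGroup.Build Q quotg_mulg_continuous quotg_invg_continuous.

End Quotg.

Section Centre.
Context {G : groupType}.

Definition centraliser (A : set G) : set G :=
  [set x | forall a, A a -> commute x a].

Definition centre (A : set G) : set G := A `&` centraliser A.

Lemma centre_group_closed : group_closed [in centre setT].
Proof.
split; first by apply/mem_set; split=> // a _; rewrite /commute mul1g mulg1.
move=> x y /set_mem [_ cx] /set_mem [_ cy]; apply/mem_set; split=> // a _.
apply/commute_sym/commuteM; first exact/commute_sym/cx.
exact/commuteV/commute_sym/cy.
Qed.

Lemma centre_normal (x g : G) : centre setT x -> centre setT (x ^ g).
Proof.
move=> [_ cx]; have -> : x ^ g = x by rewrite /conjg cx // mulgA mulVg mul1g.
by split.
Qed.

Definition centre_subgroup : normal_subgroup G :=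
  @NormalSubgroup G (Subgroup centre_group_closed) centre_normal.

End Centre.

Arguments centre_subgroup : clear implicits.

Implicit Types G Q S : topGroupType.

(* The subgroup topologically generated by A. *)
Definition topgen G (A : set G) : set G :=
  smallest [set H : set G | group_closed [in H] /\ closed H] A.

Definition trivial_group G : Prop := [set: G] = [set 1].

Definition simple S : Prop :=
  ~ trivial_group S /\
  forall N : normal_subgroup S, closed N -> N = [set 1] :> set S \/ N = setT :> set S.

Definition perfect Q : Prop :=
  topgen [set z : Q | exists x y : Q, z = [~ x, y]] = setT.

Definition quasisimple Q : Prop :=
  perfect Q /\ simple (quotg (centre_subgroup Q)).

(* Closed subgroups H = H_0 <| H_1 <| ... <| H_n = G. *)
Inductive subnormal G : set G -> Prop :=
| subnormal_setT : subnormal setT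
| subnormal_normal (H K : set G) :
    subnormal K -> group_closed [in H] -> closed H -> H `<=` K ->
    (forall x g, H x -> K g -> H (x ^ g)) -> subnormal H.

Definition component G (H : subgroup G) : Prop :=
  subnormal H /\ quasisimple (subg H).

Definition pro_p (p : nat) Q : Prop :=
  forall N : normal_subgroup Q, open N ->
    exists k : nat, [set: quotg N] #= `I_(p ^ k)%N.

Definition layer G : set G :=
  topgen (\bigcup_(H in [set H : subgroup G | component H]) H).
Arguments layer : clear implicits.

Definition proFitting G : set G :=
  topgen (\bigcup_(H in [set H : subgroup G |
    subnormal H /\ exists p : nat, prime p /\ pro_p p (subg H)]) H).
Arguments proFitting : clear implicits.

Definition gen_proFitting G : set G :=
  topgen (layer G `|` proFitting G).
Arguments gen_proFitting : clear implicits.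

Definition Fitting_degenerate G : Prop := gen_proFitting G = [set 1].

Definition Fitting_regular G : Prop :=
  forall N : normal_subgroup G, closed N ->
    ~ trivial_group (quotg N) -> ~ Fitting_degenerate (quotg N).

(* Main.v *)
From HB Require Import structures.
From mathcomp Require Import all_boot all_fingroup all_solvable.
From mathcomp Require Import boolp classical_sets functions cardinality.
From mathcomp Require Import generic_quotient topology.
Require Import Defs.

(** Write F, E and F* for the pro-Fitting subgroup, the layer and the
    generalised pro-Fitting subgroup of G, and C for the centraliser of F*.

    The inclusion Z(F) <= C says that components commute with subnormal pro-p
    subgroups.  If Q is quasisimple and subnormal, and Q normalises M, then
    M meets Q in a normal subgroup of Q, hence contains Q or meets Q in a
    central subgroup; in the second case the three subgroups lemma, applied
    along the chain from Q up to G, makes M centralise Q.  Going down a chain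
    to a subnormal subgroup P, this gives: Q lies in P or commutes with P
    (qsimple_subnormal).  A pro-p group has no non-trivial perfect subgroup, so
    Q commutes with every subnormal pro-p subgroup.

    For the inclusion C <= F, put Z = Z(C) and N = C_G(C/Z).  The engine is that
    a closed normal subgroup all of whose finite images are nilpotent lies in F
    (pronilpotent_sub_proFitting).  It applies to the intersection of N and C,
    which has class at most 2; being inside F it commutes with C, so it equals
    Z.  Consequently C/Z embeds in G/N and its image has trivial centraliser
    there.  If N = G this says that C = Z <= F.  Otherwise G/N is a non-trivial
    image of G, and Fitting-regularity gives it a non-trivial subnormal pro-p
    subgroup or a component.

    - The subnormal pro-p subgroups of G/N lie in a normal subgroup O of
      p-elements.  The part R of C lying over O is a central extension of a
      pro-p group by Z, so R <= F, so R = Z.  Thus O commutes with CN/N, and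
      O = 1.
    - A component P of G/N does not commute with CN/N, so P <= CN/N.  If S is
      the part of C lying over P, then the closed derived subgroup D of S is a
      perfect central extension of P, hence a component of G inside C.  But C
      commutes with the layer, so D is abelian, which is absurd.

    Both cases are impossible, which proves C <= F. *)

Set Implicit Arguments.
Unset Strict Implicit.
Unset Printing Implicit Defensive.

Local Open Scope classical_set_scope.
Local Open Scope card_scope.
Local Open Scope quotient_scope.
Local Open Scope group_scope.

(** * Compact spaces *)

Section CompactSpaces.
Context {T : topologicalType}.

(** Otherwise the sets f i minus O generate a proper filter, and a cluster point
    of it lies in every f i but not in O. *)
Lemma compact_directed (I : Type) (D : set I) (f : I -> set T) (O : set T) :
  compact [set: T] -> open O -> D !=set0 ->
  (forall i j, D i -> D j -> exists2 k, D k & f k `<=` f i `&` f j) ->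
  (forall i, D i -> closed (f i)) -> \bigcap_(i in D) f i `<=` O ->
  exists2 i, D i & f i `<=` O.
Proof.
move=> cT oO D0 dir cf capO; apply: contrapT => nex.
pose F := filter_from D (fun i => f i `\` O).
have FF : ProperFilter F.
  apply: filter_from_proper => [|i Di]; last first.
    apply/set0P/negP => /eqP e; apply: nex; exists i => // x fix_.
    by apply: contrapT => nOx; have : (f i `\` O) x by []; rewrite e.
  apply: filter_from_filter => // i j Di Dj.
  have [k Dk kij] := dir i j Di Dj; exists k => // x [fkx nOx].
  by have [? ?] := kij _ fkx.
have [p [_ clp]] : [set: T] `&` cluster F !=set0 by apply: cT; exact: filterT.
have fp i : D i -> (f i `\` O) p.
  move=> Di; have : closed (f i `\` O).
    by apply: closedI; [exact: cf|exact: open_closedC].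
  by apply => B pB; apply: clp => //; exists i.
have Op : O p by apply: capO => i /fp[].
by have [i /fp[]] := D0.
Qed.

(** Components coincide with quasi-components: the intersection Q of the clopen
    neighbourhoods of x is connected.  Indeed, if Q is the disjoint union of two
    closed sets, the one containing x has an open neighbourhood U whose closure
    misses the other one, and by compactness some clopen K around x avoids the
    boundary of U; then K meets U in a clopen set, which must contain Q. *)
Lemma compact_hausdorff_clopen (x y : T) :
  compact [set: T] -> hausdorff_space T -> totally_disconnected [set: T] ->
  x <> y -> exists K : set T, [/\ clopen K, K x & ~ K y].
Proof.
move=> cT hT tdT xy; apply: contrapT => nex.
pose Q := \bigcap_(K in [set K : set T | clopen K /\ K x]) K.
have clQ : closed Q by apply: closed_bigI => K [[]].
have Qx : Q x by move=> K [].
have Qy : Q y.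
  move=> K [cK Kx]; apply: contrapT => nKy; apply: nex; exists K; split=> //.
have split_Q (A B : set T) : closed A -> closed B -> A x -> A `&` B = set0 ->
    Q `<=` A `|` B -> Q `&` B = set0.
  move=> cA cB Ax AB0 QAB.
  have [W nW WB] : filter_from (set_nbhs A) closure (~` B).
    apply: compact_normal => // z Az; apply: open_nbhs_nbhs; split.
      exact: closed_openC.
    by move=> Bz; have : (A `&` B) z by []; rewrite AB0.
  have [U [oU AU UW]] := (set_nbhsP _ _).1 nW.
  have clUB : closure U `&` B = set0.
    apply/disjoints_subset; apply: subset_trans WB; exact: closureS.
  have oE : open (U `|` ~` closure U).
    by apply: openU => //; apply: closed_openC; exact: closed_closure.
  have [|K1 K2 [c1 K1x] [c2 K2x]|K [[]]//|z Qz|K [cK Kx] KE] :=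
    @compact_directed _ [set K : set T | clopen K /\ K x] id _ cT oE.
  - by exists setT; split=> //; exact: clopenT.
  - by exists (K1 `&` K2) => //; split; [exact: clopenI|].
  - have /QAB[Az|Bz] := Qz; first by left; exact: AU.
    by right => Uz; have : (closure U `&` B) z by []; rewrite clUB.
  have KU : K `&` U = K `&` closure U.
    apply/seteqP; split=> z [Kz Uz]; split=> //; first exact: subset_closure.
    by have /KE[] := Kz.
  have cKU : clopen (K `&` U).
    case: cK => oK cK; split; first exact: openI.
    by rewrite KU; apply: closedI => //; exact: closed_closure.
  apply/disjoints_subset => z Qz Bz.
  have [|_ Uz] := Qz (K `&` U); first by split=> //; split=> //; exact: AU.
  by have : (closure U `&` B) z; [split=> //; exact: subset_closure|rewrite clUB].
suff cQ : connected Q.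
  have : connected_component [set: T] x y by exists Q.
  by rewrite tdT // => /esym.
move=> B B0 [O oO eO] [C cC eC].
have cB : closed B by rewrite eC; exact: closedI.
have cB' : closed (Q `\` B).
  have -> : Q `\` B = Q `&` ~` O.
    apply/seteqP; split=> z [Qz nz]; split=> //.
      by move=> Oz; apply: nz; rewrite eO.
    by rewrite eO => -[].
  by apply: closedI => //; exact: open_closedC.
have BQ : B `<=` Q by rewrite eC => z [].
have [Bx|nBx] := pselect (B x).
  have : Q `&` (Q `\` B) = set0.
    apply: (split_Q B) => //; first by rewrite setDIK.
    by move=> z Qz; have [|] := pselect (B z); [left|right].
  move=> e; apply/seteqP; split=> // z Qz; apply: contrapT => nBz.
  by have : (Q `&` (Q `\` B)) z by []; rewrite e.
have e : Q `&` B = set0.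
  apply: (split_Q (Q `\` B)) => //; first by rewrite setDKI.
  by move=> z Qz; have [|] := pselect (B z); [right|left].
case: B0 => z Bz.
by have : (Q `&` B) z; [split=> //; exact: BQ|rewrite e].
Qed.

End CompactSpaces.

(** * Subgroups as sets of group elements *)

Definition normalised_by (G : groupType) (K A : set G) :=
  forall x g, A x -> K g -> A (x ^ g).

(** The product set A U, with the factor from U eliminated. *)
Definition pset (G : groupType) (A U : set G) : set G :=
  [set x | exists2 a, A a & U (a^-1 * x)].

Section GroupSets.
Context {G : groupType}.
Implicit Types A B H K U : set G.

Lemma gset_intro A : A 1 -> (forall x y, A x -> A y -> A (x * y)) ->
  (forall x, A x -> A x^-1) -> group_closed [in A].
Proof.
move=> A1 AM AV; split; first exact: mem_set.
by move=> x y /set_mem Ax /set_mem Ay; apply/mem_set/AM => //; exact: AV.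
Qed.

Section Closed.
Context {A : set G} (gA : group_closed [in A]).

Lemma gset1 : A 1. Proof. exact: (subgroup1 (Subgroup gA)). Qed.

Lemma gsetM x y : A x -> A y -> A (x * y).
Proof. exact: (@subgroupM _ (Subgroup gA)). Qed.

Lemma gsetV x : A x -> A x^-1.
Proof. exact: (@subgroupV _ (Subgroup gA)). Qed.

Lemma gsetX x n : A x -> A (x ^+ n).
Proof.
move=> Ax; elim: n => [|n IH]; first exact: gset1.
by rewrite expgS; exact: gsetM.
Qed.

Lemma gsetJ x y : A x -> A y -> A (x ^ y).
Proof. by move=> Ax Ay; apply/gsetM/gsetM => //; exact: gsetV. Qed.

Lemma gsetR x y : A x -> A y -> A [~ x, y].
Proof. by move=> Ax Ay; apply/gsetM/gsetJ => //; exact: gsetV. Qed.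

Lemma gset_mull x y : A x -> A (x * y) -> A y.
Proof. by move=> Ax Axy; rewrite -[y](mulKg x); apply/gsetM => //; exact: gsetV. Qed.

End Closed.

Lemma gsetT : group_closed [in [set: G]].
Proof. exact: gset_intro. Qed.

Lemma gsetI A B : group_closed [in A] -> group_closed [in B] ->
  group_closed [in A `&` B].
Proof.
move=> gA gB; apply: gset_intro; first by split; exact: gset1.
- by move=> x y [? ?] [? ?]; split; exact: gsetM.
- by move=> x [? ?]; split; exact: gsetV.
Qed.

Lemma gset_bigcap (I : Type) (D : set I) (F : I -> set G) :
  (forall i, D i -> group_closed [in F i]) ->
  group_closed [in \bigcap_(i in D) F i].
Proof.
move=> gF; apply: gset_intro; first by move=> i /gF; exact: gset1.
- by move=> x y Fx Fy i Di; apply: gsetM; [exact: gF|exact: Fx|exact: Fy].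
- by move=> x Fx i Di; apply: gsetV; [exact: gF|exact: Fx].
Qed.

Lemma centraliser_gset A : group_closed [in centraliser A].
Proof.
apply: gset_intro; first by move=> a _; rewrite /commute mul1g mulg1.
- move=> x y cx cy a Aa; apply/commute_sym/commuteM; apply/commute_sym.
    exact: cx.
  exact: cy.
- by move=> x cx a Aa; apply/commute_sym/commuteV/commute_sym/cx.
Qed.

Lemma centraliser_normal A K : normalised_by K A -> group_closed [in K] ->
  normalised_by K (centraliser A).
Proof.
move=> nA gK x g cx Kg a Aa; rewrite -[a](conjgKV g) /commute -!conjMg.
by congr (_ ^ _); apply: cx; apply: nA => //; exact: gsetV.
Qed.

Lemma centraliserS A B : A `<=` B -> centraliser B `<=` centraliser A.
Proof. by move=> AB x cx a /AB; exact: cx. Qed.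

Lemma centraliser_sym A B : A `<=` centraliser B -> B `<=` centraliser A.
Proof. by move=> AB b Bb a Aa; apply/commute_sym/(AB a). Qed.

Lemma commR_sub A B H : group_closed [in H] -> normalised_by B H -> A `<=` H ->
  forall a b, A a -> B b -> H [~ a, b].
Proof.
move=> gH nH AH a b Aa Bb; apply: (gsetM gH); first exact/(gsetV gH)/AH.
by apply: nH => //; exact: AH.
Qed.

Lemma normalisedT A K : normalised_by setT A -> normalised_by K A.
Proof. by move=> n x g Ax _; exact: n. Qed.

Lemma normalisedI A B K : normalised_by K A -> normalised_by K B ->
  normalised_by K (A `&` B).
Proof. by move=> nA nB x g [? ?] ?; split; [exact: nA|exact: nB]. Qed.

Lemma pset_gset A U : group_closed [in A] -> group_closed [in U] ->
  normalised_by A U -> group_closed [in pset A U].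
Proof.
move=> gA gU nU; apply: gset_intro.
- by exists 1; rewrite ?invg1 ?mul1g; exact: gset1.
- move=> x y [a Aa ax] [b Ab bx]; exists (a * b); first exact: gsetM.
  have -> : (a * b)^-1 * (x * y) = (a^-1 * x) ^ b * (b^-1 * y).
    by rewrite /conjg !gnorm.
  by apply: gsetM => //; exact: nU.
- move=> x [a Aa ax]; exists a^-1; first exact: gsetV.
  have -> : a^-1^-1 * x^-1 = (a^-1 * x)^-1 ^ a^-1.
    by rewrite /conjg !gnorm.
  by apply: nU; apply: gsetV.
Qed.

Lemma pset_subl A U : U 1 -> A `<=` pset A U.
Proof. by move=> U1 a Aa; exists a; rewrite ?mulVg. Qed.

Lemma Hall_Witt (x y z : G) :
  [~ x, y^-1, z] ^ y * [~ y, z^-1, x] ^ z * [~ z, x^-1, y] ^ x = 1.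
Proof. by rewrite /commg /conjg !gnorm. Qed.

(** The three subgroups lemma for a subset X that need not be a subgroup: two of
    the three factors of the Hall-Witt identity are trivial. *)
Lemma three_subgroups A (X : set G) : group_closed [in A] ->
  (forall x, X x -> X x^-1) ->
  (forall x a, X x -> A a -> centraliser A [~ x, a]) ->
  forall x a b, X x -> A a -> A b -> commute x [~ a, b].
Proof.
move=> gA XV XA x a b Xx Aa Ab; apply/commute_sym/commgP.
have := Hall_Witt x a b^-1.
have -> : [~ x, a^-1, b^-1] = 1.
  by apply/eqP/commgP; apply: XA => //; exact: gsetV.
have -> : [~ b^-1, x^-1, a] = 1.
  apply/eqP/commgP; rewrite -invgR; apply/commute_sym/commuteV/commute_sym.
  by apply: XA => //; [exact: XV|exact: gsetV].
rewrite invgK !conj1g mul1g mulg1 => /eqP.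
by rewrite conjg_eq1.
Qed.

End GroupSets.

(** * Topological and profinite groups *)

Definition open_normal (G : topGroupType) (U : set G) :=
  [/\ group_closed [in U], normalised_by setT U & open U].

Section TopGroups.
Context {G : topGroupType}.
Implicit Types A B H K U V : set G.

Lemma topgroup_cvgV (T : topologicalType) (f : T -> G) :
  continuous f -> continuous (fun x => (f x)^-1).
Proof. by move=> cf x; apply: continuous_comp; [exact: cf|exact: invg_continuous]. Qed.

Lemma topgroup_cvgJ (T : topologicalType) (f g : T -> G) :
  continuous f -> continuous g -> continuous (fun x => f x ^ g x).
Proof.
move=> cf cg; apply: topgroup_cvgM; first exact: topgroup_cvgV.
exact: topgroup_cvgM.
Qed.

Lemma topgroup_cvgR (T : topologicalType) (f g : T -> G) :
  continuous f -> continuous g -> continuous (fun x => [~ f x, g x]).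
Proof.
move=> cf cg; apply: topgroup_cvgM; first exact: topgroup_cvgV.
exact: topgroup_cvgJ.
Qed.

Lemma continuous_idg : continuous (fun x : G => x).
Proof. by move=> x; exact: cvg_id. Qed.

Lemma continuous_cstg (g : G) : continuous (fun _ : G => g).
Proof. by move=> x; exact: cvg_cst. Qed.

Lemma open_preim (f : G -> G) U : continuous f -> open U -> open [set x | U (f x)].
Proof. by move=> /continuousP; exact. Qed.

Lemma closed_preim (f : G -> G) A :
  continuous f -> closed A -> closed [set x | A (f x)].
Proof. by move=> /continuous_closedP; exact. Qed.

Lemma gset_nbhs_open A : group_closed [in A] -> nbhs 1 A -> open A.
Proof.
move=> gA nA; rewrite openE => a Aa; change (nbhs a A).
have cm : continuous (fun x : G => a^-1 * x).
  by apply: topgroup_cvgM; [exact: continuous_cstg|exact: continuous_idg].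
have h : nbhs a [set x | A (a^-1 * x)] by apply: cm; rewrite mulVg.
apply: filterS h => x /= Aax.
by rewrite -[x](mulVKg a); exact: gsetM.
Qed.

(** A is a union of cosets of U, and so is its complement. *)
Lemma invariant_clopen U A : open U -> group_closed [in U] ->
  (forall x y, A x -> U (x^-1 * y) -> A y) -> clopen A.
Proof.
move=> oU gU.
have opn B : (forall x y, B x -> U (x^-1 * y) -> B y) -> open B.
  move=> BU; rewrite openE => x Bx; change (nbhs x B).
  have cm : continuous (fun y : G => x^-1 * y).
    by apply: topgroup_cvgM; [exact: continuous_cstg|exact: continuous_idg].
  have nU : nbhs x [set y | U (x^-1 * y)].
    by apply: cm; rewrite mulVg; apply: open_nbhs_nbhs; split=> //; exact: gset1.
  by apply: filterS nU => y /= /(BU _ _ Bx).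
move=> AU; split; first exact: opn.
rewrite -[A]setCK; apply: open_closedC; apply: opn => x y nAx Uxy Ay.
apply/nAx/(AU _ _ Ay); have := gsetV gU Uxy.
by rewrite invgM invgK.
Qed.

Lemma pset_clopen A U : open U -> group_closed [in U] -> clopen (pset A U).
Proof.
move=> oU gU; apply: (invariant_clopen oU gU) => x y [a Aa ax] xy; exists a => //.
by have := gsetM gU ax xy; rewrite mulgA mulgK.
Qed.

Lemma topgen_sub A : A `<=` topgen A.
Proof. by move=> x Ax H [_ ]; exact. Qed.

Lemma topgen_gset A : group_closed [in topgen A].
Proof. by rewrite /topgen /smallest; apply: gset_bigcap => H [[]]. Qed.

Lemma topgen_closed A : closed (topgen A).
Proof. by rewrite /topgen /smallest; apply: closed_bigI => H [[]]. Qed.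

Lemma topgen_min A H : group_closed [in H] -> closed H -> A `<=` H ->
  topgen A `<=` H.
Proof. by move=> gH cH AH x; apply. Qed.

Lemma topgen_normal A K : normalised_by K A -> group_closed [in K] ->
  normalised_by K (topgen A).
Proof.
move=> nA gK x g Ax Kg.
suff : topgen A `<=` [set y | topgen A (y ^ g)] by apply.
apply: topgen_min => [||a Aa].
- apply: gset_intro; first by rewrite /= conj1g; exact: gset1 (@topgen_gset A).
  + by move=> a b /= Ha Hb; rewrite conjMg; exact (gsetM (@topgen_gset A) Ha Hb).
  + by move=> a /= Ha; rewrite conjVg; exact (gsetV (@topgen_gset A) Ha).
- apply: closed_preim (@topgen_closed A).
  by apply: topgroup_cvgJ; [exact: continuous_idg|exact: continuous_cstg].
- by apply: topgen_sub; exact: nA.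
Qed.

Section Hausdorff.
Hypothesis hT : hausdorff_space G.

Lemma closed1 : closed [set 1 : G].
Proof. exact/accessible_closed_set1/hausdorff_accessible. Qed.

Lemma closed_commute (a : G) : closed [set x | commute x a].
Proof.
have -> : [set x | commute x a] = [set x | [set 1] [~ x, a]].
  by apply/seteqP; split=> x /=; [move/commgP/eqP|move/eqP/commgP].
apply: closed_preim closed1.
by apply: topgroup_cvgR; [exact: continuous_idg|exact: continuous_cstg].
Qed.

Lemma centraliser_closed A : closed (centraliser A).
Proof.
have -> : centraliser A = \bigcap_(a in A) [set x | commute x a] by [].
by apply: closed_bigI => a _; exact: closed_commute.
Qed.

Lemma centraliser_topgen A : centraliser (topgen A) = centraliser A.
Proof.
apply/seteqP; split; first by apply: centraliserS; exact: topgen_sub.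
apply: centraliser_sym; apply: topgen_min.
- exact: centraliser_gset.
- exact: centraliser_closed.
- by apply: centraliser_sym.
Qed.

End Hausdorff.

End TopGroups.

Section Profinite.
Context {G : topGroupType} (pG : profinite G).

Lemma profinite_compact : compact [set: G]. Proof. by case: pG. Qed.
Lemma profinite_hausdorff : hausdorff_space G. Proof. by case: pG. Qed.

Lemma closed_compact (A : set G) : closed A -> compact A.
Proof. by move=> cA; exact: subclosed_compact profinite_compact _. Qed.

Lemma profinite_clopen_basis (O : set G) : nbhs 1 O ->
  exists K : set G, [/\ clopen K, K 1 & K `<=` O].
Proof.
move=> nO.
have zdG : zero_dimensional G.
  move=> x y /eqP xy; have [_ _ tdG] := pG.
  have [K [? ? ?]] := compact_hausdorff_clopen profinite_compact profinite_hausdorff tdG xy.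
  by exists K.
have [K [K1 cK] KO] := zero_dimensional_cvg profinite_hausdorff zdG profinite_compact nO.
by exists K.
Qed.

(** For a clopen K around 1, take the h such that inserting h between any two
    factors does not change whether their product lies in K.  This is a normal
    subgroup contained in K, and it is a neighbourhood of 1 because the factors
    range over a compact space. *)
Lemma open_normal_basis (O : set G) : nbhs 1 O ->
  exists2 U, open_normal U & U `<=` O.
Proof.
move=> /profinite_clopen_basis[K [[oK cK] K1 KO]].
pose U := [set h : G | forall ab : G * G, K (ab.1 * ab.2) <-> K (ab.1 * h * ab.2)].
have gU : group_closed [in U].
  apply: gset_intro.
  - by move=> ab; rewrite mulg1.
  - move=> x y Ux Uy [a b]; rewrite (Ux (a, b)) /=.
    by rewrite mulgA (Uy (a * x, b)).
  - by move=> x Ux [a b]; rewrite (Ux (a * x^-1, b)) /= mulgVK.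
have nU : normalised_by setT U.
  move=> x g Ux _ [a b]; have := Ux (a * g^-1, g * b).
  by rewrite /conjg /= !mulgA !mulgVK.
exists U; last by move=> x /(_ (1, 1)) /= []; rewrite !mul1g mulg1 => + _ => /(_ K1)/KO.
split=> //; apply: gset_nbhs_open => //.
have /compact_near_coveringP ncG : compact [set: G * G].
  by rewrite -setXTT; exact: compact_setX profinite_compact profinite_compact.
pose P h (ab : G * G) := K (ab.1 * ab.2) <-> K (ab.1 * h * ab.2).
have near1 : \forall h \near (1 : G), [set: G * G] `<=` P h.
  apply: ncG.
  move=> [a b] _.
  have c3 : continuous (fun p : (G * G) * G => p.1.1 * p.2 * p.1.2).
    apply: topgroup_cvgM; first apply: topgroup_cvgM.
    - by move=> p; apply: continuous_comp; exact: cvg_fst.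
    - by move=> p; exact: cvg_snd.
    - by move=> p; apply: continuous_comp; [exact: cvg_fst|exact: cvg_snd].
  have c2 : continuous (fun p : (G * G) * G => p.1.1 * p.1.2).
    apply: topgroup_cvgM.
    - by move=> p; apply: continuous_comp; exact: cvg_fst.
    - by move=> p; apply: continuous_comp; [exact: cvg_fst|exact: cvg_snd].
  have [Kab|nKab] := pselect (K (a * b)).
    have nK : nbhs (a * b) K by exact: open_nbhs_nbhs.
    have n2 : nbhs (a, b, 1) [set p : (G * G) * G | K (p.1.1 * p.1.2)] by exact: c2.
    have n3 : nbhs (a, b, 1) [set p : (G * G) * G | K (p.1.1 * p.2 * p.1.2)].
      by apply: c3; rewrite /= mulg1.
    by apply: filterS2 n2 n3 => -[[x y] z].
  have nK : nbhs (a * b) (~` K).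
    by apply: open_nbhs_nbhs; split=> //; exact: closed_openC.
  have n2 : nbhs (a, b, 1) [set p : (G * G) * G | ~ K (p.1.1 * p.1.2)] by exact: (c2 _ (~` K)).
  have n3 : nbhs (a, b, 1) [set p : (G * G) * G | ~ K (p.1.1 * p.2 * p.1.2)].
    by apply: (c3 _ (~` K)); rewrite /= mulg1.
  by apply: filterS2 n2 n3 => -[[x y] z].
by apply: filterS near1 => h Ph ab; exact: Ph.
Qed.
End Profinite.

(** * Finite quotients *)

Section Transport.
Context {G : groupType} {n : nat} (f : G -> 'I_n) (g : 'I_n -> G).
Hypotheses (fK : cancel f g) (gK : cancel g f).

(** A group with finitely many elements carries no canonical enumeration, so its
    structure is transported to an ordinal to obtain a finGroupType.  The proofs
    that f and g are inverse index the alias to carry the group laws. *)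
Definition ord_group of cancel f g & cancel g f : Type := 'I_n.
Local Notation T := (ord_group fK gK).
HB.instance Definition _ := Finite.on T.

Definition ord_mul (a b : T) : T := f (g a * g b).
Definition ord_one : T := f 1.
Definition ord_inv (a : T) : T := f (g a)^-1.

Lemma ord_mulA : associative ord_mul.
Proof. by move=> a b c; rewrite /ord_mul !fK mulgA. Qed.

Lemma ord_mul1 : left_id ord_one ord_mul.
Proof. by move=> a; rewrite /ord_mul fK mul1g gK. Qed.

Lemma ord_mulV : left_inverse ord_one ord_inv ord_mul.
Proof. by move=> a; rewrite /ord_mul fK mulVg. Qed.

HB.instance Definition _ := Finite_isGroup.Build T ord_mulA ord_mul1 ord_mulV.

Lemma ord_groupM (x y : G) : (f (x * y) : T) = (f x : T) * (f y : T).
Proof. by rewrite [RHS]/(ord_mul _ _) /ord_mul !fK. Qed.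

End Transport.

Lemma finite_set_finGroup (Q : groupType) : finite_set [set: Q] ->
  exists (T : finGroupType) (f : Q -> T), {morph f : x y / x * y} /\ bijective f.
Proof.
move=> [n /card_set_bijP [f bf]].
have fn x : (f x < n)%N by have [hf _ _] := bf; exact: (hf x I).
pose f' x := Ordinal (fn x).
have f'inj : injective f'.
  move=> x y [fxy]; have [_ inj _] := bf; by apply: inj; rewrite ?in_setT.
have surj i : exists x, f' x = i.
  have [_ _ sf] := bf; have [x _ fx] := sf i (ltn_ord i); exists x.
  exact/val_inj.
have [g gK] := choice surj.
have fK : cancel f' g by move=> x; exact/f'inj/gK.
exists (ord_group fK gK), f'; split; first by move=> x y; exact: ord_groupM.
by exists g.
Qed.

Lemma bijective_card (Q : Type) (T : finType) (f : Q -> T) : bijective f ->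
  [set: Q] #= `I_#|T|.
Proof.
move=> bf; apply: (card_eq_trans (B := [set: T])).
  rewrite card_eq_sym; have -> : [set: T] = f @` [set: Q].
    by apply/seteqP; split=> // t _; have [g _ gK] := bf; exists (g t).
  by apply: inj_card_eq => x y _ _; exact: (bij_inj bf).
rewrite card_eq_sym; apply: (card_eq_trans card_II).
rewrite card_eq_sym; have -> : [set: 'I_#|T|] = enum_rank @` [set: T].
  by apply/seteqP; split=> // t _; exists (enum_val t); rewrite ?enum_valK.
by rewrite card_eq_sym; apply: inj_card_eq => x y _ _; exact: enum_rank_inj.
Qed.

(** Finite quotients are presented by surjections rather than by types of cosets,
    so that the theory of finite groups applies to an arbitrary T. *)
Definition is_quotient (G : groupType) (U : set G) (T : finGroupType)
  (f : G -> T) :=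
  [/\ {morph f : x y / x * y}, forall x, f x = 1 <-> U x
    & forall t, exists x, f x = t].

Definition is_image (G : groupType) (T : finGroupType) (f : G -> T)
  (H : set G) (A : {group T}) :=
  forall t, t \in A <-> exists2 x, H x & f x = t.

Section Quotients.
Context {G : groupType} {T : finGroupType} {U : set G} {f : G -> T}.
Hypothesis qf : is_quotient U f.

Let fM : {morph f : x y / x * y}. Proof. by case: qf. Qed.

Lemma quot1 : f 1 = 1.
Proof. by apply: (@mulgI _ (f 1)); rewrite -fM !mulg1. Qed.

Lemma quotV x : f x^-1 = (f x)^-1.
Proof. by apply: (@mulgI _ (f x)); rewrite -fM !mulgV quot1. Qed.

Lemma quotX x n : f (x ^+ n) = f x ^+ n.
Proof. by elim: n => [|n IH]; rewrite ?quot1 // !expgS fM IH. Qed.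

Lemma quotJ x y : f (x ^ y) = f x ^ f y.
Proof. by rewrite /conjg !fM quotV. Qed.

Lemma quotR x y : f [~ x, y] = [~ f x, f y].
Proof. by rewrite /commg fM quotV quotJ. Qed.

Lemma quot_eq x y : f x = f y <-> U (x^-1 * y).
Proof.
have [_ kf _] := qf; rewrite -kf fM quotV; split=> [->|e]; first by rewrite mulVg.
by apply: (@mulgI _ (f x)^-1); rewrite e mulVg.
Qed.

Lemma image_exists (H : set G) : group_closed [in H] ->
  exists A : {group T}, is_image f H A.
Proof.
move=> gH; pose A := [set t | `[< exists2 x, H x & f x = t >]]%SET.
have inA t : t \in A <-> exists2 x, H x & f x = t.
  by rewrite finset.in_set; split=> /asboolP.
have gA : group_set A.
  apply/group_setP; split.
    by apply/inA; exists 1; [exact: gset1|exact: quot1].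
  move=> x y /inA[a Ha <-] /inA[b Hb <-].
  by apply/inA; exists (a * b); [exact: gsetM|rewrite fM].
by exists (Group gA).
Qed.

Lemma image_mem (H : set G) A x : is_image f H A -> H x -> f x \in A.
Proof. by move=> iA Hx; apply/iA; exists x. Qed.

End Quotients.

Section FiniteQuotients.
Context {G : topGroupType} (cG : compact [set: G]).

(** The quotient is compact and discrete; on an infinite discrete space the
    cofinite filter has no cluster point. *)
Lemma quotg_finite (N : normal_subgroup G) : open N -> finite_set [set: quotg N].
Proof.
move=> oN; apply: contrapT => infQ.
have cQ : compact [set: quotg N].
  have -> : [set: quotg N] = \pi_(quotg N) @` [set: G].
    by apply/seteqP; split=> // x _; exists (generic_quotient.repr x) => //; exact: generic_quotient.reprK.
  apply: continuous_compact cG; apply: continuous_subspaceT.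
  exact: quotg_pi_continuous.
pose F : set_system (quotg N) := [set A | finite_set (~` A)].
have FF : ProperFilter F.
  split; first by rewrite /F /= setC0.
  split; first by rewrite /F /= setCT.
  - by move=> A B; rewrite /F /= setCI finite_setU.
  - by move=> A B AB; apply: sub_finite_set; exact: subsetC.
have [q [_ clq]] : [set: quotg N] `&` cluster F !=set0.
  by apply: cQ; exact: filterT.
have [] := clq (~` [set q]) [set q].
- by rewrite /F /= setCK; exact: finite_set1.
- apply: open_nbhs_nbhs; split=> //.
  suff -> : [set q] = \pi_(quotg N) @` [set x | sgset N ((generic_quotient.repr q)^-1 * x)].
    apply: quotg_pi_open; apply: open_preim => //.
    by apply: topgroup_cvgM; [exact: continuous_cstg|exact: continuous_idg].
  apply/seteqP; split=> [_ ->|_ [x Nx <-]].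
    by exists (generic_quotient.repr q); [rewrite /= mulVg; exact: subgroup1|exact: reprK].
  by rewrite /= -[q]reprK; apply/esym/quotg_eqP.
- by move=> x [].
Qed.

Lemma open_normal_NS (U : set G) : open_normal U ->
  exists2 N : normal_subgroup G, N = U :> set G & open N.
Proof.
move=> [gU nU oU].
by exists (@NormalSubgroup G (Subgroup gU) (fun x g Ux => nU x g Ux I)).
Qed.

Lemma finite_quotientP (N : normal_subgroup G) : open N ->
  exists (T : finGroupType) (h : quotg N -> T),
    [/\ {morph h : x y / x * y}, bijective h
      & is_quotient N (h \o \pi_(quotg N))].
Proof.
move=> oN; have [T [h [hM bh]]] := finite_set_finGroup (quotg_finite oN).
exists T, h; split=> //; split=> [x y|x|t] /=.
- by rewrite piM hM.
- have h1 : h 1 = 1 by apply: (@mulgI _ (h 1)); rewrite -hM !mulg1.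
  rewrite -h1; split=> [/(bij_inj bh)/esym/quotg_eqP|Nx].
    by rewrite invg1 mul1g.
  by congr h; apply/esym/quotg_eqP; rewrite invg1 mul1g.
- by have [h' _ hK] := bh; exists (generic_quotient.repr (h' t)); rewrite reprK.
Qed.

Lemma finite_quotient (U : set G) : open_normal U ->
  exists (T : finGroupType) (f : G -> T), is_quotient U f.
Proof.
move=> /open_normal_NS [N NU oN]; have [T [h [_ _ qh]]] := finite_quotientP oN.
by exists T, (h \o \pi_(quotg N)); rewrite -NU.
Qed.

(** By Lagrange and Cauchy a finite group has p-power order exactly when all its
    elements have p-power order; this turns the counting definition of pro-p
    groups into a condition on elements. *)
Lemma pro_pP p : prime p -> pro_p p G <->
  forall U : set G, open_normal U -> forall x, exists k, U (x ^+ (p ^ k)).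
Proof.
move=> pp; split=> [ppG U /open_normal_NS [N NU oN] x|pG N oN].
  have [T [h [_ bh qh]]] := finite_quotientP oN.
  have [k ck] := ppG N oN.
  have cT : #|T| = (p ^ k)%N.
    apply/card_eq_II; apply: card_eq_trans ck; rewrite card_eq_sym.
    exact: bijective_card bh.
  exists k; rewrite -NU; have [_ kf _] := qh; apply/kf.
  by rewrite (quotX qh) -cT -cardsT; apply: expg_cardG; rewrite inE.
have [T [h [_ bh qh]]] := finite_quotientP oN.
have pT : p.-group [set: T]%SET.
  apply/pgroupP => q pq /(Cauchy pq) [t _ ot].
  have [_ kf sf] := qh; have [x fx] := sf t.
  have oNN : open_normal (N : set G).
    by split=> //; [exact: subgroup_closed|move=> y g Ny _; exact: normal_subgroupJ].
  have [k /kf] := pG _ oNN x; rewrite (quotX qh) fx => /eqP.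
  rewrite -order_dvdn ot => qpk.
  by move: qpk; rewrite Euclid_dvdX // dvdn_prime2 // => /andP[].
have /p_natP [k ck] := pT; exists k.
by rewrite -ck cardsT; exact: bijective_card bh.
Qed.

End FiniteQuotients.

(** * Subgroups with the subspace topology *)

Section Subgroups.
Context {G : topGroupType} (P : subgroup G).

Definition to_subg x (Px : sgset P x) : subg P := exist _ x (mem_set Px).

Lemma subgP (x : subg P) : sgset P (val x).
Proof. by case: x => x Px; exact: set_mem. Qed.

Lemma val_subgM (x y : subg P) : val (x * y) = val x * val y.
Proof. by []. Qed.

Lemma val_subgX (x : subg P) n : val (x ^+ n) = (val x) ^+ n.
Proof. by elim: n => // n IH; rewrite !expgS val_subgM IH. Qed.

Lemma subg_open (O : set G) : open O -> open [set x : subg P | O (val x)].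
Proof. by move/continuousP: (@subg_val_continuous G P); exact. Qed.

Lemma subg_closed (A : set G) : closed A -> closed [set x : subg P | A (val x)].
Proof. by move/continuous_closedP: (@subg_val_continuous G P); exact. Qed.

Lemma subg_openE (O : set (subg P)) : open O ->
  exists2 O' : set G, open O' & O = [set x | O' (val x)].
Proof.
by move=> [O' oO' <-]; exists O' => //; apply/seteqP; split=> x; rewrite set_valE.
Qed.

Lemma subg_compact : compact [set: G] -> closed P -> compact [set: subg P].
Proof.
move=> cG cP F FF _.
pose F' : set_system G := [set A | F [set x | A (val x)]].
have FF' : ProperFilter F'.
  split; first by move=> F0; exact: (@filter_not_empty _ F FF).
  split; first exact: filterT.
  - by move=> A B FA FB; apply: filterS2 FA FB.
  - by move=> A B AB; apply: filterS => x; exact: AB.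
have cP' : compact (sgset P) by exact: subclosed_compact cG _.
have [|p [Pp clp]] := cP' F' FF'.
  suff : F [set x | sgset P (val x)] by [].
  by apply: filterS (@filterT _ F _) => x _; exact: subgP.
exists (to_subg Pp); split=> // A B FA; rewrite nbhsE => -[B' [oB' Bp] BB].
have [O oO eO] := subg_openE oB'.
have [||x [[y Ay <-] Ox]] := clp (val @` A) O.
- suff : F [set x | (val @` A) (val x)] by [].
  by apply: filterS FA => x Ax; exists x.
- by apply: open_nbhs_nbhs; split=> //; rewrite eO in Bp.
- by exists y; split=> //; apply: BB; rewrite eO.
Qed.

Lemma subg_open_normal (U : set G) : open_normal U ->
  open_normal [set x : subg P | U (val x)].
Proof.
move=> [gU nU oU]; split; last exact: subg_open.
- apply: gset_intro; first exact: (gset1 gU).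
  + by move=> x y /= Ux Uy; exact: gsetM.
  + by move=> x /= Ux; exact: gsetV.
- by move=> x g /= Ux _; exact: nU.
Qed.

Lemma subg_pro_p_pow p : prime p -> compact [set: G] -> closed P ->
  pro_p p (subg P) ->
  forall U : set G, open_normal U -> forall x, sgset P x ->
    exists k, U (x ^+ (p ^ k)).
Proof.
move=> pp cG cP /(pro_pP (subg_compact cG cP) pp) h U oU x Px.
have [k] := h _ (subg_open_normal oU) (to_subg Px); exists k.
by rewrite -[x]/(val (to_subg Px)) -val_subgX.
Qed.

Lemma pow_subg_pro_p p : prime p -> profinite G -> closed P ->
  (forall U : set G, open_normal U -> forall x, sgset P x ->
    exists k, U (x ^+ (p ^ k))) -> pro_p p (subg P).
Proof.
move=> pp pG cP h; apply/(pro_pP (subg_compact (profinite_compact pG) cP) pp).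
move=> N [gN _ oN] x; have [O oO eO] := subg_openE oN.
have [|U oU UO] := open_normal_basis pG (O := O).
  apply: open_nbhs_nbhs; split=> //.
  by have := gset1 gN; rewrite eO.
have [k Uk] := h U oU (val x) (subgP x); exists k.
by rewrite eO /= val_subgX; exact: UO.
Qed.

End Subgroups.

(** * Elements of p-power order in every finite quotient *)

(** The elements that topologically generate a pro-p group. *)
Definition p_element (G : topGroupType) (p : nat) (x : G) :=
  forall U : set G, open_normal U -> exists k, U (x ^+ (p ^ k)).

Definition commutators (G : groupType) (A : set G) : set G :=
  [set z | exists x y : G, [/\ A x, A y & z = [~ x, y]]].

Section FiniteGroups.
Context {T : finGroupType}.
Implicit Types (A : {group T}) (p : nat).

Lemma p_elt_expgn p (t : T) k : prime p -> t ^+ (p ^ k) = 1 -> p.-elt t.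
Proof.
move=> pp /eqP; rewrite -order_dvdn => /pnat_dvd; apply.
by rewrite pnatX pnat_id.
Qed.

Lemma p_elts_pgroup p A : (forall t, t \in A -> p.-elt t) -> p.-group A.
Proof.
move=> pA; apply/pgroupP => q pq /(Cauchy pq)[t At ot].
by have := pA t At; rewrite /p_elt ot pnatE.
Qed.

Lemma nilpotent_p_eltM p A x y : nilpotent A -> x \in A -> y \in A ->
  p.-elt x -> p.-elt y -> p.-elt (x * y).
Proof.
move=> nA Ax Ay; have hO := nilpotent_pcore_Hall p nA.
have memO z : z \in A -> p.-elt z = (z \in 'O_p(A)).
  by move=> Az; rewrite (mem_normal_Hall hO (pcore_normal _ _)).
by rewrite !memO ?(groupM Ax Ay) //; exact: groupM.
Qed.

End FiniteGroups.

(** The exponents m with x ^+ m in H form an ideal of the integers, which by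
    hypothesis lies in no maximal ideal. *)
Lemma expgn_coprime_mem (G : groupType) (H : set G) x : group_closed [in H] ->
  (forall p, prime p -> exists2 m, ~~ (p %| m) & H (x ^+ m)) -> H x.
Proof.
move=> gH hx.
have exm : exists m, (0 < m)%N && `[< H (x ^+ m) >].
  have [m m2 Hm] := hx 2 isT; exists m; rewrite lt0n; apply/andP; split.
    by apply: contra m2 => /eqP->.
  exact/asboolP.
(* The least positive exponent d divides all exponents; a prime factor of d would
   contradict the hypothesis. *)
case: (ex_minnP exm) => d /andP[d0 /asboolP Hd] mind.
have [d1|d1] := leqP d 1.
  by have e : d = 1%N; [apply/eqP; rewrite eqn_leq d1|rewrite e in Hd].
have pp := pdiv_prime d1; have [m pm Hm] := hx _ pp.
case/negP: pm; apply: dvdn_trans (pdiv_dvd d) _.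
have Hr : H (x ^+ (m %% d)).
  apply: (gset_mull gH (x := x ^+ (m %/ d * d))).
    by rewrite mulnC expgnA; exact: gsetX.
  by rewrite -expgnDr -divn_eq.
apply: contraT; rewrite /dvdn -lt0n => r0.
have := mind (m %% d); rewrite r0 /= => /(_ (asboolT Hr)).
by rewrite leqNgt ltn_mod d0.
Qed.

Section FiniteQuotientElements.
Context {G : topGroupType} {T : finGroupType} {U : set G} {f : G -> T}.
Hypotheses (oU : open_normal U) (qf : is_quotient U f).

Lemma p_element_quot (p : nat) x : prime p -> p_element p x -> p.-elt (f x).
Proof.
move=> pp /(_ U oU) [k Uk]; apply: (@p_elt_expgn _ _ _ k) => //.
by rewrite -(quotX qf); have [_ kf _] := qf; apply/kf.
Qed.

Lemma quot_p_elt (p : nat) x : p.-elt (f x) -> exists k, U (x ^+ (p ^ k)).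
Proof.
move=> /p_natP[k ok]; exists k; have [_ kf _] := qf; apply/kf.
by rewrite (quotX qf) -ok expg_order.
Qed.

Lemma preim_clopen (A : {set T}) : clopen [set x | f x \in A].
Proof.
have [gU _ opU] := oU; apply: (invariant_clopen opU gU) => x y /=.
by move=> Ax /(quot_eq qf) <-.
Qed.

Lemma preim_gset (A : {group T}) : group_closed [in [set x | f x \in A]].
Proof.
have [fM _ _] := qf; apply: gset_intro => /=.
- by rewrite (quot1 qf) group1.
- by move=> x y /= Ax Ay; rewrite fM groupM.
- by move=> x /= Ax; rewrite (quotV qf) groupV.
Qed.

End FiniteQuotientElements.

Section Compact.
Context {G : topGroupType} (cG : compact [set: G]).

Lemma open_normal_expgn (U : set G) x : open_normal U ->
  exists2 n, (0 < n)%N & forall k, (n <= k)%N -> U (x ^+ k`!).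
Proof.
move=> oU; have [T [f qf]] := finite_quotient cG oU.
exists #|T|; first by apply/card_gt0P; exists 1.
move=> k Tk; have [_ kf _] := qf; apply/kf; rewrite (quotX qf).
have /dvdnP[m ->] : #|T| %| k`!.
  by apply: dvdn_fact; rewrite Tk andbT; apply/card_gt0P; exists 1.
rewrite mulnC expgM; have -> : f x ^+ #|T| = 1.
  by rewrite -cardsT; apply: expg_cardG; rewrite inE.
by rewrite expg1n.
Qed.

Lemma p_element_closed p : closed (p_element (G := G) p).
Proof.
have -> : p_element (G := G) p =
    \bigcap_(U in @open_normal G) [set x | exists k, U (x ^+ (p ^ k))].
  by apply/seteqP; split=> x h U /= /h.
apply: closed_bigI => U oU; have [T [f qf]] := finite_quotient cG oU.
have [gU _ opU] := oU.
suff [] : clopen [set x | exists k, U (x ^+ (p ^ k))] by [].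
apply: (invariant_clopen opU gU) => x y /= [k Uk] /(quot_eq qf) fxy; exists k.
have [_ kf _] := qf; move: Uk; rewrite -!kf !(quotX qf).
by rewrite fxy.
Qed.

Lemma p_elementJ p (x g : G) : p_element p x -> p_element p (x ^ g).
Proof.
move=> px U oU; have [k Uk] := px U oU; exists k.
by have [_ nU _] := oU; rewrite -conjXg; exact: nU.
Qed.

End Compact.

(** * Pronilpotent and pro-p subgroups *)

Lemma normal_subnormal (G : topGroupType) (R : set G) : group_closed [in R] ->
  closed R -> normalised_by setT R -> subnormal R.
Proof.
by move=> gR cR nR; apply: (@subnormal_normal G R setT) => //; exact: subnormal_setT.
Qed.

Lemma subnormal_gset (G : topGroupType) (R : set G) : subnormal R ->
  group_closed [in R].
Proof. by case=> [|H K _ gH _ _ _] //; exact: gsetT. Qed.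

Lemma subnormal_closed (G : topGroupType) (R : set G) : subnormal R -> closed R.
Proof. by case=> [|H K _ _ cH _ _] //; exact: closedT. Qed.

Section Profinite.
Context {G : topGroupType} (pG : profinite G).
Let cG := profinite_compact pG.

Lemma closed_mem_pset (A : set G) x : closed A ->
  (forall U, open_normal U -> pset A U x) -> A x.
Proof.
move=> cA Ax; apply: contrapT => nAx.
pose O := [set u : G | ~ A (x * u)].
have nO : nbhs 1 O.
  apply: open_nbhs_nbhs; split; last by rewrite /O /= mulg1.
  apply: (@open_preim _ (fun u => x * u) (~` A)); last exact: closed_openC.
  by apply: topgroup_cvgM; [exact: continuous_cstg|exact: continuous_idg].
have [U oU UO] := open_normal_basis pG nO.
have [a Aa Uax] := Ax U oU; have [gU _ _] := oU.
apply: (UO _ (gsetV gU Uax)).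
by rewrite invgM invgK mulVKg.
Qed.

Lemma open_normal_sep (x : G) : (forall U, open_normal U -> U x) -> x = 1.
Proof.
move=> Ux; apply: (@closed_mem_pset [set 1]); first exact/closed1/profinite_hausdorff.
by move=> U oU; exists 1; rewrite ?invg1 ?mul1g //; exact: Ux.
Qed.

(** The element y generates the p-part of the procyclic group of x: it is a
    cluster point of the powers of x by the p'-parts of the factorials, which kill the
    p'-part of x in any given finite quotient while staying prime to p. *)
Lemma cluster_p_part (R : set G) (p : nat) x : prime p -> closed R ->
  group_closed [in R] -> R x ->
  exists y, [/\ R y, p_element p y & forall U, open_normal U ->
    exists2 m, ~~ (p %| m) & U (y^-1 * x ^+ m)].
Proof.
move=> pp cR gR Rx; pose m k := (k`!`_p^')%N.
pose F := filter_from setT (fun n => [set x ^+ m k | k in [set k | (n <= k)%N]]).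
have FF : ProperFilter F.
  apply: filter_from_proper => [|n _]; last by exists (x ^+ m n), n => /=.
  apply: filter_from_filter; first by exists 0.
  move=> i j _ _; exists (maxn i j) => // _ [k /= + <-].
  by rewrite geq_max => /andP[ik jk]; split; exists k.
have cmpR : compact R by exact: closed_compact.
have [|y [Ry cly]] := cmpR F FF.
  by exists 0 => // _ [k _ <-]; exact: gsetX.
have near_y n (U : set G) : open_normal U ->
    exists2 k, (n <= k)%N & U (y^-1 * x ^+ m k).
  move=> [gU _ oU].
  have nU : nbhs y [set z | U (y^-1 * z)].
    apply: open_nbhs_nbhs; split; last by rewrite /= mulVg; exact: gset1.
    apply: open_preim oU.
    by apply: topgroup_cvgM; [exact: continuous_cstg|exact: continuous_idg].
  have FB : F [set x ^+ m k | k in [set k | (n <= k)%N]] by exists n.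
  by have [_ [[k nk <-] Uk]] := cly _ _ FB nU; exists k.
exists y; split=> // U oU.
- have [n n0 xn] := open_normal_expgn cG x oU.
  have [k nk /= Uk] := near_y n U oU; exists (logn p k`!).
  have [T [f qf]] := finite_quotient cG oU.
  move: Uk => /(quot_eq qf) fy; have [_ kf _] := qf.
  apply/kf; rewrite (quotX qf) fy -(quotX qf) -expgnA -p_part mulnC partnC.
    by apply/kf; exact: xn.
  exact: fact_gt0.
- have [k _ Uk] := near_y 0 U oU; exists (m k) => //.
  by rewrite -p'natE // /m; exact: part_pnat.
Qed.

Lemma pro_p_sub_proFitting (P : set G) (p : nat) : prime p -> subnormal P ->
  (forall x, P x -> p_element p x) -> P `<=` proFitting G.
Proof.
move=> pp sP eP x Px; apply: topgen_sub.
exists (Subgroup (subnormal_gset sP)) => //=; split=> //; exists p; split=> //.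
apply: pow_subg_pro_p => //; first exact: subnormal_closed.
by move=> U oU z Pz; exact: eP.
Qed.

(** The p-elements of R form a closed normal pro-p subgroup of G, because this
    holds in the nilpotent images of R; so they lie in F(G).  They generate R:
    modulo U, the set of exponents m with x ^+ m in F(G) contains for each prime
    p a number prime to p. *)
Lemma pronilpotent_sub_proFitting (R : set G) : closed R -> group_closed [in R] ->
  normalised_by setT R ->
  (forall U (T : finGroupType) (f : G -> T) A, open_normal U ->
     is_quotient U f -> is_image f R A -> nilpotent A) ->
  R `<=` proFitting G.
Proof.
move=> cR gR nR nilR x Rx.
have subF p : prime p -> R `&` p_element (G := G) p `<=` proFitting G.
  move=> pp; apply: (pro_p_sub_proFitting pp); last by move=> z [].
  apply: normal_subnormal.
  - have pX (z : G) n : p_element p z -> p_element p (z ^+ n).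
      move=> pz U oU; have [k Uk] := pz U oU; exists k.
      by rewrite expgnAC; have [gU _ _] := oU; exact: gsetX.
    apply: gset_intro.
    + split; first exact: gset1.
      by move=> U [gU _ _]; exists 0; rewrite expg1; exact: gset1.
    + move=> a b [Ra pa] [Rb pb]; split; first exact: gsetM.
      move=> U oU; have [T [f qf]] := finite_quotient cG oU.
      have [A iA] := image_exists qf gR.
      apply: (quot_p_elt qf); have [fM _ _] := qf; rewrite fM.
      apply: (nilpotent_p_eltM (nilR U T f A oU qf iA)).
      * exact: image_mem iA Ra.
      * exact: image_mem iA Rb.
      * exact (p_element_quot oU qf pp pa).
      * exact (p_element_quot oU qf pp pb).
    + move=> a [Ra pa]; split; first exact: gsetV.
      move=> U oU; have [k Uk] := pa U oU; exists k.
      by have [gU _ _] := oU; rewrite expVgn; exact: gsetV.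
  - by apply: closedI => //; exact: p_element_closed.
  - by move=> a g [Ra pa] _; split; [exact: nR|exact: p_elementJ].
apply: closed_mem_pset; first exact: topgen_closed.
move=> U oU; have [gU nU opU] := oU.
have gF : group_closed [in proFitting G] by exact: topgen_gset.
apply: (@expgn_coprime_mem _ (pset (proFitting G) U)).
  by apply: pset_gset => //; exact: normalisedT.
move=> p pp; have [y [Ry py hy]] := cluster_p_part pp cR gR Rx.
have [m pm Um] := hy U oU; exists m => //; exists y => //.
exact: (subF p).
Qed.

(** The images of Q in finite quotients are perfect finite p-groups, hence
    trivial. *)
Lemma perfect_pro_p_trivial (p : nat) (Q : set G) : prime p ->
  group_closed [in Q] -> (forall x, Q x -> p_element p x) ->
  Q `<=` topgen (commutators Q) -> Q `<=` [set 1].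
Proof.
move=> pp gQ pQ perfQ x Qx; apply: open_normal_sep => U oU.
have [T [f qf]] := finite_quotient cG oU.
have [A iA] := image_exists qf gQ.
have pA : p.-group A.
  by apply: p_elts_pgroup => t /iA[a Qa <-]; exact (p_element_quot oU qf pp (pQ a Qa)).
have sA : A \subset A^`(1)%G.
  apply/fintype.subsetP => t /iA[a Qa <-].
  suff : topgen (commutators Q) `<=` [set z | f z \in A^`(1)%G].
    by apply; exact: perfQ.
  apply: topgen_min.
  - exact: (preim_gset qf).
  - by have [_] := preim_clopen oU qf A^`(1)%G.
  - move=> _ [b [c [Qb Qc ->]]] /=; rewrite (quotR qf).
    by apply: mem_commg; exact: image_mem iA _.
have A1 : A :=: 1.
  apply/eqP; apply: contraTT sA => nA.
  have := sol_der1_proper (nilpotent_sol (pgroup_nil pA)) (subxx _) nA.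
  by rewrite properE => /andP[].
have : f x \in A by exact: image_mem iA Qx.
by rewrite A1 inE => /eqP; have [_ kf _] := qf => /kf.
Qed.

End Profinite.

Section SubnormalProP.
Context {G : topGroupType} (cG : compact [set: G]).

(** The p-core of a normal subgroup is characteristic in it, so p-cores grow along
    a subnormal chain. *)
Lemma subnormal_pcore (H : set G) : subnormal H ->
  forall (T : finGroupType) (f : G -> T) U (A : {group T}) (p : nat),
  is_quotient U f -> is_image f H A -> 'O_p(A) \subset 'O_p([set: T])%SET.
Proof.
elim=> [|{}H K sK IH gH _ HK nHK] T f U A p qf iA.
  have -> : A :=: [set: T]%SET; last by [].
  apply/finset.setP => t; rewrite inE; apply/iA.
  by have [_ _ /(_ t)[x fx]] := qf; exists x.
have [B iB] := image_exists qf (subnormal_gset sK).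
apply: fintype.subset_trans (IH _ _ _ _ p qf iB).
apply: pcore_max; first exact: pcore_pgroup.
apply: gFnormal_trans; apply/andP; split.
  by apply/fintype.subsetP => t /iA[x Hx <-]; apply: image_mem iB _; exact: HK.
apply/fintype.subsetP => t /iB[x Kx <-]; rewrite inE.
apply/fintype.subsetP => _ /imsetP[s /iA[y Hy <-] ->].
by rewrite -(quotJ qf); apply: image_mem iA _; exact: nHK.
Qed.

(** A closed normal subgroup of p-elements standing in for the normal closure of
    the subnormal pro-p subgroups. *)
Definition pro_p_core (p : nat) : set G :=
  [set x | forall (U : set G) (T : finGroupType) (f : G -> T),
    open_normal U -> is_quotient U f -> f x \in 'O_p([set: T])%SET].

Lemma pro_p_core_gset p : group_closed [in pro_p_core p].
Proof.
apply: gset_intro.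
- by move=> U T f oU qf; rewrite (quot1 qf) group1.
- move=> x y px py U T f oU qf; have [fM _ _] := qf; rewrite fM.
  by apply: groupM; [exact: px qf|exact: py qf].
- by move=> x px U T f oU qf; rewrite (quotV qf) groupV; exact: px qf.
Qed.

Lemma pro_p_core_normal p : normalised_by setT (pro_p_core p).
Proof.
move=> x g px _ U T f oU qf; rewrite (quotJ qf) memJ_norm; first exact: px qf.
by apply: (fintype.subsetP (normal_norm (pcore_normal _ _))); rewrite inE.
Qed.

Lemma pro_p_core_elt p x : pro_p_core p x -> p_element p x.
Proof.
move=> px U oU; have [T [f qf]] := finite_quotient cG oU.
apply: (quot_p_elt qf); apply: mem_p_elt (px U T f oU qf).
exact: pcore_pgroup.
Qed.

Lemma subnormal_pro_p_core p (P : subgroup G) : prime p -> subnormal P ->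
  pro_p p (subg P) -> P `<=` pro_p_core p.
Proof.
move=> pp sP ppP x Px U T f oU qf.
have [A iA] := image_exists qf (subgroup_closed P).
apply: (fintype.subsetP (subnormal_pcore sP p qf iA)).
rewrite pcore_pgroup_id; first exact: image_mem iA Px.
apply: p_elts_pgroup => t /iA[a Pa <-].
have [k Uk] := subg_pro_p_pow pp cG (subnormal_closed sP) ppP oU Pa.
apply: (@p_elt_expgn _ _ _ k) => //.
by rewrite -(quotX qf); have [_ kf _] := qf; apply/kf.
Qed.

End SubnormalProP.

(** * Quotients by closed normal subgroups and quasisimple subgroups *)

(** If p and q differ, x^-1 y stays away from 1 for x near p and y near q. *)
Lemma closed1_hausdorff (G : topGroupType) : closed [set 1 : G] ->
  hausdorff_space G.
Proof.
move=> c1 p q clpq; apply: contrapT => pq.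
have cm : continuous (fun x : G * G => x.1^-1 * x.2).
  apply: topgroup_cvgM; last by move=> x; exact: cvg_snd.
  by apply: topgroup_cvgV => x; exact: cvg_fst.
have nO : nbhs (p, q) [set x : G * G | x.1^-1 * x.2 <> 1].
  apply: (cm (p, q) (~` [set 1])); apply: open_nbhs_nbhs; split.
    exact: closed_openC.
  by move=> /= /mulg1_eq; rewrite invgK.
case: nO => -[A B] /= [nA nB] AB; have [z [Az Bz]] := clpq A B nA nB.
by apply: (AB (z, z)) => //=; rewrite mulVg.
Qed.

Section QuotientGroups.
Context {G : topGroupType} (N : normal_subgroup G).
Local Notation Q := (quotg N).
Local Notation pi := (\pi_Q).

Lemma quot_surj (q : Q) : exists x, pi x = q.
Proof. by exists (generic_quotient.repr q); exact: reprK. Qed.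

Lemma quot_pi1 (x : G) : pi x = 1 <-> sgset N x.
Proof.
split=> [/esym/quotg_eqP|Nx]; first by rewrite invg1 mul1g.
by apply/esym/quotg_eqP; rewrite invg1 mul1g.
Qed.

Lemma piX (x : G) n : pi (x ^+ n) = pi x ^+ n.
Proof. by elim: n => // n IH; rewrite !expgS piM IH. Qed.

Lemma piJ (x y : G) : pi (x ^ y) = pi x ^ pi y.
Proof. by rewrite /conjg !piM piV. Qed.

Lemma piR (x y : G) : pi [~ x, y] = [~ pi x, pi y].
Proof. by rewrite /commg piM piV piJ. Qed.

Lemma quot_closed (A : set Q) : closed [set x | A (pi x)] -> closed A.
Proof. by move=> cA; rewrite -[A]setCK; apply: open_closedC; exact: closed_openC cA. Qed.

Lemma closed_quot_preim (A : set Q) : closed A -> closed [set x | A (pi x)].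
Proof. by move/continuous_closedP: (@quotg_pi_continuous G N); exact. Qed.

Lemma quotg_hausdorff : closed N -> hausdorff_space Q.
Proof.
move=> cN; apply: closed1_hausdorff; apply: quot_closed.
by have -> : [set x | [set 1] (pi x)] = N; [apply/seteqP; split=> x /= /quot_pi1|].
Qed.

Lemma quotg_compact : compact [set: G] -> compact [set: Q].
Proof.
move=> cG; have -> : [set: Q] = pi @` [set: G].
  by apply/seteqP; split=> // q _; have [x xq] := quot_surj q; exists x.
apply: continuous_compact cG; apply: continuous_subspaceT.
exact: quotg_pi_continuous.
Qed.

Lemma pi_image_closed (A : set G) : compact [set: G] -> closed N -> closed A ->
  closed (pi @` A).
Proof.
move=> cG cN cA; apply: compact_closed; first exact: quotg_hausdorff.
apply: continuous_compact; last exact: subclosed_compact cG _.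
by apply: continuous_subspaceT; exact: quotg_pi_continuous.
Qed.

Lemma pi_preim_gset (A : set Q) : group_closed [in A] ->
  group_closed [in [set x | A (pi x)]].
Proof.
move=> gA; apply: gset_intro => /= [|x y Ax Ay|x Ax].
- have -> : pi 1 = 1 by apply/quot_pi1; exact: subgroup1.
  exact: gset1.
- by rewrite piM; exact: gsetM.
- by rewrite piV; exact: gsetV.
Qed.

Lemma pi_image_gset (A : set G) : group_closed [in A] ->
  group_closed [in pi @` A].
Proof.
move=> gA; apply: gset_intro => [|_ _ [x Ax <-] [y Ay <-]|_ [x Ax <-]].
- by exists 1; [exact: gset1|apply/quot_pi1; exact: subgroup1].
- by exists (x * y); [exact: gsetM|rewrite piM].
- by exists x^-1; [exact: gsetV|rewrite piV].
Qed.

Lemma pi_image_normal (A K : set G) : normalised_by K A ->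
  normalised_by (pi @` K) (pi @` A).
Proof.
move=> nA _ _ [x Ax <-] [k Kk <-]; exists (x ^ k); first exact: nA.
by rewrite piJ.
Qed.

Lemma pi_open_normal (U : set G) : open_normal U -> open_normal (pi @` U).
Proof.
move=> [gU nU oU]; split; [exact: pi_image_gset| |exact: quotg_pi_open].
move=> _ q [x Ux <-] _; have [g <-] := quot_surj q.
by rewrite -piJ; exists (x ^ g) => //; exact: nU.
Qed.

Lemma subnormal_pi_preim (A : set Q) : subnormal A -> subnormal [set x | A (pi x)].
Proof.
elim=> [|H K sK IH gH cH HK nHK]; first exact: subnormal_setT.
apply: (subnormal_normal IH).
- exact: pi_preim_gset.
- exact: closed_quot_preim.
- by move=> x; exact: HK.
- by move=> x g /= Hx Kg; rewrite piJ; exact: nHK.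
Qed.

End QuotientGroups.

Lemma subnormalI (G : topGroupType) (H C : set G) : subnormal H ->
  group_closed [in C] -> closed C -> normalised_by setT C -> subnormal (H `&` C).
Proof.
move=> sH gC cC nC; elim: sH => [|{}H K sK IH gH cH HK nHK].
  by rewrite setTI; exact: normal_subnormal.
apply: (subnormal_normal IH).
- exact: gsetI.
- exact: closedI.
- by move=> x [/HK].
- by move=> x g [Hx Cx] [Kg _]; split; [exact: nHK|exact: nC].
Qed.

(** Quasisimplicity of a subgroup expressed inside the ambient group: the closed
    normal subgroups of Q are Q itself and central ones.  The quotient of Q by
    its centre being non-trivial becomes non-commutativity of Q. *)
Definition qsimple (G : topGroupType) (Q : set G) :=
  [/\ Q `<=` topgen (commutators Q), ~ (Q `<=` centraliser Q)
    & forall K : set G, closed K -> group_closed [in K] -> K `<=` Q ->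
        normalised_by Q K -> Q `<=` K \/ K `<=` centraliser Q].

Lemma commR_central (G : groupType) (H : set G) x y z t :
  group_closed [in H] -> H x -> H y -> centraliser H z -> centraliser H t ->
  H t -> [~ x * z, y * t] = [~ x, y].
Proof.
move=> gH Hx Hy cz ct Ht.
have J1 (u v : G) : commute u v -> v ^ u = v by move=> uv; rewrite /conjg -uv mulKg.
have cR (u v : G) : commute u v -> [~ u, v] = 1 by move=> /commgP/eqP.
have -> : [~ x * z, y * t] = [~ x, y * t] ^ z * [~ z, y * t].
  by rewrite /commg /conjg !gnorm.
have -> : [~ x, y * t] = [~ x, t] * [~ x, y] ^ t.
  by rewrite /commg /conjg !gnorm.
rewrite (cR z) ?mulg1; last by apply: cz; exact: gsetM.
rewrite (cR x t) ?mul1g; last by apply/commute_sym/ct.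
rewrite (J1 t) ?(J1 z) //; first by apply: cz; exact: gsetR.
by apply: ct; exact: gsetR.
Qed.

Section QuasisimpleSubgroups.
Context {G : topGroupType} (cG : compact [set: G]) (hG : hausdorff_space G).
Context (H : subgroup G) (cH : closed H).

Let gH : group_closed [in sgset H] := subgroup_closed H.

Lemma val_image_closed (A : set (subg H)) : closed A -> closed (val @` A).
Proof.
move=> cA; apply: compact_closed => //; apply: continuous_compact.
  by apply: continuous_subspaceT; exact: subg_val_continuous.
exact: subclosed_compact (subg_compact cG cH) _.
Qed.

Lemma val_image_gset (A : set (subg H)) : group_closed [in A] ->
  group_closed [in val @` A].
Proof.
move=> gA; apply: gset_intro => [|_ _ [x Ax <-] [y Ay <-]|_ [x Ax <-]].
- by exists 1 => //; exact: gset1.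
- by exists (x * y) => //; exact: gsetM.
- by exists x^-1 => //; exact: gsetV.
Qed.

Lemma val_preim_gset (A : set G) : group_closed [in A] ->
  group_closed [in [set x : subg H | A (val x)]].
Proof.
move=> gA; apply: gset_intro => /= [|x y Ax Ay|x Ax].
- exact: (gset1 gA).
- exact: (gsetM gA).
- exact: (gsetV gA).
Qed.

Lemma perfect_subgP : perfect (subg H) <-> H `<=` topgen (commutators H).
Proof.
rewrite /perfect; split=> [perfH x Hx|perfH].
  suff : topgen [set z : subg H | exists x y, z = [~ x, y]] `<=`
      [set z | topgen (commutators H) (val z)].
    by rewrite perfH => /(_ (to_subg Hx)); exact.
  apply: topgen_min.
  - apply: val_preim_gset; exact: topgen_gset.
  - apply: subg_closed; exact: topgen_closed.
  - move=> _ [a [b ->]]; apply: topgen_sub; exists (val a), (val b).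
    by split=> //; exact: subgP.
apply/seteqP; split=> // z _; set D := topgen _.
have : topgen (commutators H) `<=` val @` D.
  apply: topgen_min.
  - apply: val_image_gset; exact: topgen_gset.
  - apply: val_image_closed; exact: topgen_closed.
  - move=> _ [a [b [Ha Hb ->]]]; exists [~ to_subg Ha, to_subg Hb] => //.
    by apply: topgen_sub; exists (to_subg Ha), (to_subg Hb).
move=> /(_ _ (perfH _ (subgP z)))[d Dd /val_inj <-]; exact Dd.
Qed.

Local Notation Z := (centre_subgroup (subg H)).

Lemma subg_centreP (x : subg H) : sgset Z x <-> centraliser H (val x).
Proof.
split=> [[_ cx] a Ha|cx].
  by have := cx (to_subg Ha) I; move=> /(congr1 val).
by split=> // a _; apply: val_inj; apply: (cx _ (subgP a)).
Qed.

Lemma subg_centre_closed : closed Z.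
Proof.
have -> : sgset Z = [set x | centraliser H (val x)].
  by apply/seteqP; split=> x /subg_centreP.
by apply: subg_closed; exact: centraliser_closed.
Qed.

(** The image of K in the quotient of H by its centre is closed and normal.  If it
    is everything, every commutator of H is a commutator of K, as central factors
    drop out, and H <= K since H is perfect. *)
Lemma quasisimple_qsimple : quasisimple (subg H) -> qsimple H.
Proof.
move=> [/perfect_subgP perfH [ntS simS]]; split=> //.
  move=> Hc; apply: ntS; apply/seteqP; split=> // q _.
  have [x <-] := quot_surj q; apply/quot_pi1/subg_centreP/Hc; exact: subgP.
move=> K cK gK KH nK.
pose K' := [set x : subg H | K (val x)].
have gK' : group_closed [in K'] by exact: val_preim_gset.
have nN : forall x g : quotg Z, (\pi_(quotg Z) @` K') x -> (\pi_(quotg Z) @` K') (x ^ g).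
  move=> _ g [x Kx <-]; have [y <-] := quot_surj g; exists (x ^ y); last by rewrite piJ.
  by apply: nK => //; exact: subgP.
pose N := @NormalSubgroup (quotg Z) (Subgroup (pi_image_gset Z gK')) nN.
have cN : closed N.
  apply: pi_image_closed; first exact: subg_compact.
    exact: subg_centre_closed.
  exact: subg_closed.
have [N1|NT] := simS N cN; [right|left].
  move=> x Kx; apply/(@subg_centreP (to_subg (KH x Kx)))/quot_pi1.
  have : sgset N (\pi_(quotg Z) (to_subg (KH x Kx))) by exists (to_subg (KH x Kx)).
  by rewrite N1.
apply: subset_trans perfH _; apply: topgen_min => //.
have dec x (Hx : sgset H x) : exists k z, [/\ K k, sgset H z, centraliser H z & x = k * z].
  have : sgset N (\pi_(quotg Z) (to_subg Hx)) by rewrite NT.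
  move=> [k Kk /quotg_eqP /subg_centreP cz].
  exists (val k), ((val k)^-1 * x); split=> //; last by rewrite mulVKg.
  by apply: (gsetM gH) => //; apply: (gsetV gH); exact: subgP.
move=> _ [a [b [/dec[k [z [Kk Hz cz ->]]] /dec[l [t [Kl Ht ct ->]]] ->]]].
rewrite (commR_central gH) //; [exact: gsetR|exact: KH|exact: KH].
Qed.

Lemma qsimple_quasisimple : qsimple H -> quasisimple (subg H).
Proof.
move=> [perfH ncH simH]; split; first exact/perfect_subgP.
split.
  move=> triv; apply: ncH => x Hx.
  apply/(@subg_centreP (to_subg Hx))/quot_pi1.
  have : [set: quotg Z] (\pi_(quotg Z) (to_subg Hx)) by [].
  by rewrite triv.
move=> N cN.
pose K' := [set x : subg H | sgset N (\pi_(quotg Z) x)].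
have [| | | |HK|Kc] := simH (val @` K').
- by apply: val_image_closed; exact: closed_quot_preim.
- by apply: val_image_gset; apply: pi_preim_gset; exact: subgroup_closed.
- by move=> _ [x _ <-]; exact: subgP.
- move=> _ g [x Kx <-] Hg; exists (x ^ to_subg Hg) => //.
  by rewrite /K' /= piJ; exact: normal_subgroupJ.
- right; apply/seteqP; split=> // q _; have [x <-] := quot_surj q.
  by have [y Ky /val_inj <-] := HK _ (subgP x).
- left; apply/seteqP; split=> q; last by move=> ->; exact: subgroup1.
  have [x <-] := quot_surj q => Nx; apply/quot_pi1/subg_centreP.
  by apply: Kc; exists x.
Qed.

End QuasisimpleSubgroups.

(** * Components *)

Section Components.
Context {G : topGroupType} (hG : hausdorff_space G).
Context (Q : set G) (gQ : group_closed [in Q]) (cQ : closed Q).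

(** By the three subgroups lemma X commutes with commutators of Q, which
    topologically generate Q. *)
Lemma perfect_three (X : set G) : Q `<=` topgen (commutators Q) ->
  (forall x, X x -> X x^-1) ->
  (forall x q, X x -> Q q -> centraliser Q [~ x, q]) -> X `<=` centraliser Q.
Proof.
move=> perfQ XV XQ x Xx.
suff : centraliser (topgen (commutators Q)) x.
  by move=> h q Qq; apply: h; exact: perfQ.
rewrite centraliser_topgen // => _ [a [b [Qa Qb ->]]].
exact: (three_subgroups gQ XV XQ).
Qed.

Hypothesis qQ : qsimple Q.

(** If the intersection of M with H centralises Q and H is normal in K, then for x
    in the intersection of M with K and q in Q the commutator [~ x, q] lies in
    both M and H, hence commutes with Q. *)
Lemma qsimple_centralised_by_normalised (M : set G) : group_closed [in M] ->
  normalised_by Q M -> forall H, subnormal H -> Q `<=` H ->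
  M `&` H `<=` centraliser Q -> M `<=` centraliser Q.
Proof.
move=> gM nM H sH; elim: sH => [_|{}H K sK IH gH _ HK nHK QH MHc].
  by rewrite setIT.
have gK := subnormal_gset sK; have [perfQ _ _] := qQ.
apply: IH; first by move=> x /QH/HK.
apply: perfect_three => // [x [Mx Kx]|x q [Mx Kx] Qq].
  by split; exact: gsetV.
apply: MHc; split; first exact: (commR_sub gM nM _ Mx Qq).
rewrite commgEr; apply: (gsetM gH); last exact: QH.
by apply: nHK => //; apply/(gsetV gH)/QH.
Qed.

Hypothesis sQ : subnormal Q.

Lemma qsimple_normalised (M : set G) : closed M -> group_closed [in M] ->
  normalised_by Q M -> Q `<=` M \/ M `<=` centraliser Q.
Proof.
move=> cM gM nM; have [_ _ simQ] := qQ.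
have [||x []//|x g [Mx Qx] Qg|QM|MQc] := simQ (M `&` Q).
- exact: closedI.
- exact: gsetI.
- by split; [exact: nM|exact: gsetJ].
- by left=> x /QM[].
- by right; exact: qsimple_centralised_by_normalised sQ _ MQc.
Qed.

(** As long as Q lies in a member of the chain from G down to P, it normalises the
    next member, and the previous dichotomy applies. *)
Lemma qsimple_subnormal (P : set G) : subnormal P ->
  Q `<=` P \/ P `<=` centraliser Q.
Proof.
elim=> [|H K sK IH gH cH HK nHK]; first by left.
have [QK|Kc] := IH; last by right=> x /HK/Kc.
by apply: qsimple_normalised => // x g Hx /QK; exact: nHK.
Qed.

End Components.

Section Main.
Context {G : topGroupType} (pG : profinite G).
Let cG := profinite_compact pG.
Let hG := profinite_hausdorff pG.

(** A component cannot be contained in a subnormal pro-p subgroup, since it is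
    perfect and non-trivial. *)
Lemma component_centralises_proFitting (Q : subgroup G) : component Q ->
  proFitting G `<=` centraliser Q.
Proof.
move=> [sQ /(quasisimple_qsimple cG hG (subnormal_closed sQ)) qQ].
have gQ := subgroup_closed Q; have cQ := subnormal_closed sQ.
have [perfQ ncQ _] := qQ.
apply: topgen_min; [exact: centraliser_gset|exact: centraliser_closed|].
move=> x [P [sP [p [pp ppP]]] Px].
have [QP|] := qsimple_subnormal hG gQ cQ qQ sQ sP; last exact.
case: ncQ => y Qy z Qz.
have Q1 : Q `<=` [set 1].
  apply: (perfect_pro_p_trivial pG pp gQ _ perfQ) => u /QP Pu U oU.
  exact: (subg_pro_p_pow pp cG (subnormal_closed sP) ppP oU Pu).
by rewrite (Q1 y Qy); rewrite /commute mul1g mulg1.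
Qed.

Lemma centre_proFitting_sub :
  centre (proFitting G) `<=` centraliser (gen_proFitting G).
Proof.
move=> x [Fx cFx]; rewrite centraliser_topgen // => a [La|/cFx //].
suff : centraliser (layer G) x by exact.
rewrite centraliser_topgen // => b [Q cQ Qb].
exact: (component_centralises_proFitting cQ Fx).
Qed.

(** The finite images of R have nilpotency class at most 2. *)
Lemma central_abelian_sub_proFitting (R : set G) : closed R ->
  group_closed [in R] -> normalised_by setT R ->
  (forall x y, R x -> R y -> centraliser R [~ x, y]) -> R `<=` proFitting G.
Proof.
move=> cR gR nR Rc; apply: pronilpotent_sub_proFitting => // U T f A oU qf iA.
rewrite -quotient_center_nil; apply: abelian_nil; apply: sub_der1_abelian.
rewrite gen_subG; apply/fintype.subsetP => _ /imset2P[_ _ /iA[a Ra <-] /iA[b Rb <-] ->].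
rewrite -(quotR qf); apply/centerP; split.
  by apply: image_mem iA _; exact: gsetR.
move=> _ /iA[c Rc' <-]; have [fM _ _] := qf.
by rewrite /commute -!fM; congr f; exact: Rc.
Qed.

(** Modulo their centres, which contain the images of Z, the finite images of R
    are p-groups. *)
Lemma central_pro_p_sub_proFitting (R Z : set G) (p : nat) : prime p -> closed R ->
  group_closed [in R] -> normalised_by setT R -> Z `<=` R ->
  Z `<=` centraliser R ->
  (forall x U, R x -> open_normal U -> exists k, pset Z U (x ^+ (p ^ k))) ->
  R `<=` proFitting G.
Proof.
move=> pp cR gR nR ZR Zc Rp; apply: pronilpotent_sub_proFitting => // U T f A oU qf iA.
rewrite -quotient_center_nil; apply: (@pgroup_nil _ p).
apply: p_elts_pgroup => u /morphimP[t Nt At ->].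
have /iA[x Rx fx] := At; have [k [z Zz /(quot_eq qf) fz]] := Rp x U Rx oU.
apply: (@p_elt_expgn _ _ _ k) => //.
rewrite -morphX //; apply: coset_id; rewrite -fx -(quotX qf) -fz.
apply/centerP; split; first by apply: image_mem iA _; exact: ZR.
move=> _ /iA[c Rc <-]; have [fM _ _] := qf.
by rewrite /commute -!fM; congr f; exact: Zc.
Qed.

End Main.

(** * Commutators and conjugates of subnormal subgroups *)

(** For a fixed U membership depends only on the coset of U, so the condition is
    clopen. *)
Lemma pro_p_core_closed (G : topGroupType) p : closed (@pro_p_core G p).
Proof.
have -> : @pro_p_core G p = \bigcap_(U in @open_normal G)
    [set x | forall (T : finGroupType) (f : G -> T), is_quotient U f ->
      f x \in 'O_p([set: T])%SET].
  by apply/seteqP; split=> x px U; [move=> oU T f|move=> T f oU] => qf; exact: px qf.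
apply: closed_bigI => U [gU _ oU].
apply: (invariant_clopen oU gU _).2 => x y px Uxy T f qf.
by rewrite -((quot_eq qf x y).2 Uxy); exact: px.
Qed.

Section Conjugates.
Context {G : topGroupType}.

Definition conj_preim (g : G) (A : set G) : set G := [set x | A (x ^ g)].
Local Notation cj := conj_preim.

Lemma conj_preimK g A x : cj g A (x ^ g^-1) = A x.
Proof. by rewrite /cj /= conjgKV. Qed.

Lemma conj_preim_gset g A : group_closed [in A] -> group_closed [in cj g A].
Proof.
move=> gA; apply: gset_intro; rewrite /cj /=.
- by rewrite conj1g; exact: gset1.
- by move=> x y Ax Ay; rewrite conjMg; exact: gsetM.
- by move=> x Ax; rewrite conjVg; exact: gsetV.
Qed.

Lemma conj_preim_closed g A : closed A -> closed (cj g A).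
Proof.
move=> cA; apply: closed_preim cA.
by apply: topgroup_cvgJ; [exact: continuous_idg|exact: continuous_cstg].
Qed.

Lemma conj_preim_normal g A K : normalised_by K A -> normalised_by (cj g K) (cj g A).
Proof. by move=> nA x y Ax Ky; rewrite /cj /= conjJg; exact: nA. Qed.

Lemma conj_preim_subnormal g A : subnormal A -> subnormal (cj g A).
Proof.
elim=> [|H K sK IH gH cH HK nHK]; first exact: subnormal_setT.
apply: (subnormal_normal IH); [exact: conj_preim_gset|exact: conj_preim_closed| |exact: conj_preim_normal].
by move=> x; exact: HK.
Qed.

Lemma conj_preim_qsimple g A : qsimple A -> qsimple (cj g A).
Proof.
move=> [perfA ncA simA]; split.
- move=> x Ax; rewrite -[x](conjgK g).
  suff : topgen (commutators A) `<=` cj g^-1 (topgen (commutators (cj g A))).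
    by apply; exact: perfA.
  apply: topgen_min.
  + apply: conj_preim_gset; exact: topgen_gset.
  + apply: conj_preim_closed; exact: topgen_closed.
  + move=> _ [a [b [Aa Ab ->]]]; apply: topgen_sub.
    by exists (a ^ g^-1), (b ^ g^-1); rewrite conjRg !conj_preimK.
- move=> Ac; apply: ncA => x Ax y Ay; apply: (@conjg_inj _ g^-1).
  by rewrite !conjMg; apply: Ac; rewrite conj_preimK.
- move=> K cK gK KA nK.
  have [| | | |AK|Kc] := simA (cj g^-1 K).
  + exact: conj_preim_closed.
  + exact: conj_preim_gset.
  + by move=> x /KA; rewrite conj_preimK.
  + by move=> x y Kx Ay; rewrite /cj /= conjJg; apply: nK; rewrite ?conj_preimK.
  + by left=> x Ax; have := AK _ Ax; rewrite /cj /= conjgK.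
  + right=> x Kx y Ay; apply: (@conjg_inj _ g); rewrite !conjMg.
    by apply: Kc => //; rewrite /cj /= conjgK.
Qed.

End Conjugates.

(** Conjugation permutes the components and the subnormal pro-p subgroups. *)
Lemma gen_proFitting_normal (G : topGroupType) : profinite G ->
  normalised_by setT (gen_proFitting G).
Proof.
move=> pG; have [cG hG _] := pG.
apply: topgen_normal; last exact: gsetT.
move=> x g [Lx|Fx] _; [left|right].
  move: x g Lx I; apply: topgen_normal; last exact: gsetT.
  move=> x g [Q [sQ qQ] Qx] _.
  have gQ : group_closed [in conj_preim g^-1 Q].
    by apply: conj_preim_gset; exact: subgroup_closed.
  have sQ' := conj_preim_subnormal g^-1 sQ.
  exists (Subgroup gQ); last by rewrite /= /conj_preim /= conjgK.
  split=> //; apply: qsimple_quasisimple => //; first exact: subnormal_closed sQ'.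
  by apply: conj_preim_qsimple; apply: quasisimple_qsimple qQ => //; exact: subnormal_closed sQ.
move: x g Fx I; apply: topgen_normal; last exact: gsetT.
move=> x g [P [sP [p [pp ppP]]] Px] _.
have sP' := conj_preim_subnormal g^-1 sP.
have gP' := subnormal_gset sP'.
exists (Subgroup gP'); last by rewrite /= /conj_preim /= conjgK.
split=> //; exists p; split=> //.
apply: pow_subg_pro_p => //; first exact: subnormal_closed sP'.
move=> U oU y Py; have [gU nU _] := oU.
have [k Uk] := subg_pro_p_pow pp cG (subnormal_closed sP) ppP oU Py.
by exists k; rewrite -conjXg in Uk; have := nU _ g Uk I; rewrite conjgKV.
Qed.

Lemma subnormal_commutators (G : topGroupType) (S : set G) : subnormal S ->
  topgen (commutators S) `<=` S /\ subnormal (topgen (commutators S)).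
Proof.
move=> sS; have gS := subnormal_gset sS.
have DS : topgen (commutators S) `<=` S.
  apply: topgen_min => //; first exact: subnormal_closed.
  by move=> _ [a [b [Sa Sb ->]]]; exact: gsetR.
split=> //; apply: (subnormal_normal sS) => //.
- exact: topgen_gset.
- exact: topgen_closed.
- apply: topgen_normal => // _ g [a [b [Sa Sb ->]]] Sg.
  by exists (a ^ g), (b ^ g); rewrite conjRg; split=> //; exact: gsetJ.
Qed.

Lemma component_layer (G : topGroupType) (Q : subgroup G) : component Q ->
  Q `<=` layer G.
Proof. by move=> cQ x Qx; apply: topgen_sub; exists Q. Qed.

(** * The centraliser of the generalised pro-Fitting subgroup *)

Section Centraliser.
Context {G : topGroupType} (pG : profinite G).
Let cG := profinite_compact pG.
Let hG := profinite_hausdorff pG.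

Local Notation F := (proFitting G).
(* C, Z = Z(C) and N = C_G(C/Z) are the subgroups of the introduction. *)
Let C := centraliser (gen_proFitting G).
Let Z := C `&` centraliser C.
Let N := [set g | forall c, C c -> Z [~ c, g]].

Lemma centraliser_genF_normal : normalised_by setT C.
Proof.
by apply: centraliser_normal; [exact: gen_proFitting_normal|exact: gsetT].
Qed.

Let gC : group_closed [in C]. Proof. exact: centraliser_gset. Qed.
Let cC : closed C. Proof. exact: centraliser_closed. Qed.
Let gZ : group_closed [in Z].
Proof. by apply: gsetI => //; exact: centraliser_gset. Qed.
Let cZ : closed Z.
Proof. by apply: closedI => //; exact: centraliser_closed. Qed.
Let nZ : normalised_by setT Z.
Proof.
apply: normalisedI; first exact: centraliser_genF_normal.
by apply: centraliser_normal; [exact: centraliser_genF_normal|exact: gsetT].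
Qed.

Let gN : group_closed [in N].
Proof.
apply: gset_intro.
- by move=> c _; rewrite commg1; exact: gset1.
- move=> g h Ng Nh c Cc; have -> : [~ c, g * h] = [~ c, h] * [~ c, g] ^ h.
    by rewrite /commg /conjg !gnorm.
  by apply: (gsetM gZ); [exact: Nh|apply: nZ => //; exact: Ng].
- move=> g Ng c Cc; have -> : [~ c, g^-1] = ([~ c, g]^-1) ^ g^-1.
    by rewrite /commg /conjg !gnorm.
  by apply: nZ => //; apply: (gsetV gZ); exact: Ng.
Qed.

Let cN : closed N.
Proof.
have -> : N = \bigcap_(c in C) [set g | Z [~ c, g]] by [].
apply: closed_bigI => c _; apply: closed_preim cZ.
by apply: topgroup_cvgR; [exact: continuous_cstg|exact: continuous_idg].
Qed.

Let nN (x g : G) : N x -> N (x ^ g).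
Proof.
move=> Nx c Cc; have -> : [~ c, x ^ g] = [~ c ^ g^-1, x] ^ g.
  by rewrite conjRg conjgKV.
by apply: nZ => //; apply: Nx; exact: centraliser_genF_normal.
Qed.

Let NS := @NormalSubgroup G (Subgroup gN) nN.

Lemma CF_sub_Z : C `&` F `<=` Z.
Proof.
move=> x [Cx Fx]; split=> // c Cc; apply/commute_sym/Cc.
by apply: topgen_sub; right.
Qed.

Lemma NC_sub_F : N `&` C `<=` F.
Proof.
apply: (@central_abelian_sub_proFitting _ pG (N `&` C)) => //.
- exact: closedI.
- exact: gsetI.
- by apply: normalisedI; [move=> y g Ny _; exact: nN|exact: centraliser_genF_normal].
- move=> y z [Ny Cy] [Nz Cz] c [_ Cc]; have [_ h] := Nz y Cy.
  exact: h.
Qed.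

Lemma NC_sub_Z : N `&` C `<=` Z.
Proof.
by move=> x [Nx Cx]; apply: CF_sub_Z; split=> //; exact: NC_sub_F.
Qed.

(** The image of C in G/N has trivial centraliser: a commutator of C lying in N
    lies in the intersection of N and C, which is Z. *)
Lemma commute_mod_N g : (forall c, C c -> N [~ c, g]) -> N g.
Proof.
move=> h c Cc; apply: NC_sub_Z; split; first exact: h.
exact: (commR_sub gC centraliser_genF_normal (fun _ h => h) Cc I).
Qed.

Let H := quotg NS.
Let cH : compact [set: H] := quotg_compact (N := NS) cG.
Let hH : hausdorff_space H := @quotg_hausdorff G NS cN.

(** P lies in the p-core O of G/N.  The part R of C over O satisfies R <= F, hence
    R <= Z, so O commutes with the image of C. *)
Lemma quotient_pro_p_trivial (P : subgroup H) (p : nat) : prime p ->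
  subnormal P -> pro_p p (subg P) -> P `<=` [set 1].
Proof.
move=> pp sP ppP q Pq.
have := subnormal_pro_p_core cH pp sP ppP Pq.
have [g <-] := quot_surj q => Og; apply/quot_pi1/commute_mod_N => c Cc.
pose R := C `&` [set x | pro_p_core p (\pi_H x)].
have gO : group_closed [in pro_p_core p] := @pro_p_core_gset H p.
have gR : group_closed [in R].
  apply: gsetI => //; exact: (@pi_preim_gset _ NS).
have nR : normalised_by setT R.
  apply: normalisedI; first exact: centraliser_genF_normal.
  by move=> x y /= Ox _; rewrite piJ; exact: pro_p_core_normal.
have ZN : Z `<=` N.
  move=> z [Cz cz] d Cd; have -> : [~ d, z] = 1; last exact: gset1.
  by apply/eqP/commgP/commute_sym/cz.
have RF : R `<=` F.
  apply: (@central_pro_p_sub_proFitting _ pG R Z p) => //.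
  - apply: closedI => //; apply: (@closed_quot_preim _ NS); exact: pro_p_core_closed.
  - move=> z Zz; split; first by case: Zz.
    rewrite /=; have -> : \pi_H z = 1 by apply/quot_pi1; exact: ZN.
    exact: gset1.
  - by move=> z [_ cz] x [Cx _]; exact: cz.
  move=> x U [Cx Ox] oU; have [gU nU opU] := oU.
  (* The sets N V shrink to N as V shrinks, so by compactness their traces on C
     eventually fall into the neighbourhood Z U of the trace Z of N. *)
  have [V oV VU] : exists2 V, open_normal V & pset N V `&` C `<=` pset Z U.
    apply: compact_directed cG _ _ _ _ _.
    + by have [] := pset_clopen Z opU gU.
    + by exists U.
    + move=> V W [gV nV oV] [gW nW oW]; exists (V `&` W).
        split; [exact: gsetI|exact: normalisedI|exact: openI].
      by move=> y [[a Na [? ?]] Cy]; split; split=> //; exists a.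
    + move=> V [gV nV oV]; apply: closedI => //.
      by have [] := pset_clopen N oV gV.
    + move=> y hy; apply: pset_subl; first exact: (gset1 gU).
      apply: NC_sub_Z; split; last by have [] := hy _ oU.
      by apply: (closed_mem_pset pG) => // V oV; have [] := hy _ oV.
  have [k [v Vv]] := pro_p_core_elt cH Ox (pi_open_normal NS oV).
  rewrite -piX => /quotg_eqP vx; exists k; apply: VU; split; last exact (gsetX gC _ Cx).
  have [gV nV _] := oV.
  (* The power is v n with n in N; as V is normal it is also n times an element
     of V. *)
  exists (v^-1 * x ^+ (p ^ k)) => //.
  by rewrite invgM invgK -mulgA; exact: nV.
have ZR : R `<=` Z by move=> x Rx; apply: CF_sub_Z; split; [case: Rx|exact: RF].
apply/ZN/ZR; split.
  exact: (commR_sub gC centraliser_genF_normal (fun _ h => h) Cc I).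
rewrite /= piR commgEr; apply: (gsetM gO) => //.
by apply: pro_p_core_normal => //; exact (gsetV gO Og).
Qed.

(** The part S of C over P is a central extension of P by Z, so its closed derived
    subgroup D maps onto P and is perfect.  A closed normal subgroup of D maps
    onto P or into its centre, which makes D quasisimple, hence a component of G
    lying in C; then D commutes with itself. *)
Lemma quotient_no_component (P : subgroup H) : component P -> False.
Proof.
move=> [sP qP0]; have cP := subnormal_closed sP.
have qP := quasisimple_qsimple cH hH cP qP0; have [perfP ncP simP] := qP.
have gP := subgroup_closed P.
have piN (x : G) : \pi_H x = 1 -> N x by move/quot_pi1.
pose M := \pi_H @` C.
(* Otherwise M would centralise P, and P would be trivial. *)
have PM : P `<=` M.
  have [|||//|Mc] := qsimple_normalised hH gP cP qP sP (M := M).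
  - exact: (@pi_image_closed _ NS).
  - exact: (@pi_image_gset _ NS).
  - move=> _ q [c Cc <-] _; have [g <-] := quot_surj q.
    by exists (c ^ g); [exact: centraliser_genF_normal|rewrite piJ].
  case: ncP => q Pq.
  suff -> : q = 1 by move=> a _; rewrite /commute mul1g mulg1.
  move: Pq; have [g <-] := quot_surj q => Pg; apply/quot_pi1/commute_mod_N => c Cc.
  apply: piN; rewrite piR; apply/eqP/commgP; apply: Mc => //.
  by exists c.
pose S := [set x | sgset P (\pi_H x)] `&` C.
have sS : subnormal S.
  by apply: subnormalI => //; [exact: (@subnormal_pi_preim _ NS)|exact: centraliser_genF_normal].
have [DS sD] := subnormal_commutators sS; set D := topgen _ in DS sD.
have gD := subnormal_gset sD; have cD := subnormal_closed sD.
have DC : D `<=` C by move=> x /DS[].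
have modZ x y : C x -> C y -> \pi_H x = \pi_H y -> Z (x^-1 * y).
  move=> Cx Cy /quotg_eqP Nxy; apply: NC_sub_Z; split=> //.
  exact (gsetM gC (gsetV gC Cx) Cy).
have ZS z (A : set G) : Z z -> A `<=` C -> centraliser A z.
  by move=> [_ cz] AC a /AC; exact: cz.
have liftC q : sgset P q -> exists2 c, S c & \pi_H c = q.
  by move=> Pq; have [c Cc cq] := PM q Pq; exists c => //; split; rewrite /= ?cq.
have PD : P `<=` \pi_H @` D.
  apply: classical_sets.subset_trans perfP _; apply: topgen_min.
  - exact: (@pi_image_gset _ NS).
  - exact: (@pi_image_closed _ NS).
  - move=> _ [a [b [/liftC[c Sc <-] /liftC[d Sd <-] ->]]].
    by exists [~ c, d]; [apply: topgen_sub; exists c, d|rewrite piR].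
(* If A still covers P, elements of S are those of A up to central factors from Z,
   which do not change commutators. *)
have decomp (A : set G) : group_closed [in A] -> A `<=` C ->
    P `<=` \pi_H @` A -> commutators S `<=` commutators A.
  move=> gA AC PA _ [x [y [[/PA[a Aa ax] Cx] [/PA[b Ab by_] Cy] ->]]].
  exists a, b; split=> //.
  have [Ca Cb] := (AC a Aa, AC b Ab).
  have [_ zx] := modZ a x Ca Cx ax; have [Ct ty] := modZ b y Cb Cy by_.
  by rewrite -[x](mulVKg a) -[y](mulVKg b) (commR_central gC).
have perfD : D `<=` topgen (commutators D).
  apply: topgen_min; [exact: topgen_gset|exact: topgen_closed|].
  by apply: classical_sets.subset_trans (decomp D gD DC PD) _; exact: topgen_sub.
have qD : qsimple D.
  split=> //.
  - move=> Dc; apply: ncP => p /PD[x Dx <-] q /PD[y Dy <-].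
    by rewrite /commute -!piM (Dc x Dx y Dy).
  - move=> K cK gK KD nK.
    have [||q|||] := simP (\pi_H @` K).
    + exact: (@pi_image_closed _ NS).
    + exact: (@pi_image_gset _ NS).
    + by move=> [k /KD/DS[Pk _] <-].
    + by move=> q r Kq /PD Dr; exact: (@pi_image_normal _ NS _ _ nK).
    + move=> PK; left; apply: topgen_min => //.
      apply: classical_sets.subset_trans (decomp K gK (classical_sets.subset_trans KD DC) PK) _.
      by move=> _ [a [b [Ka Kb ->]]]; exact: gsetR.
    + move=> Kc; right; apply: (perfect_three hG gD perfD) => [k|k d Kk Dd].
        exact: gsetV.
      apply: (ZS _ _ _ DC); have Cd := DC d Dd; have Ck := DC k (KD k Kk).
      apply: NC_sub_Z; split; last exact: (gsetR gC).
      apply: piN; rewrite piR; apply/eqP/commgP; apply: Kc; first by exists k.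
      by have [] := DS d Dd.
have cDG : component (Subgroup gD).
  by split=> //; exact: qsimple_quasisimple.
have [_ ncD _] := qD; apply: ncD => x Dx y Dy; apply: (DC x Dx).
by apply: topgen_sub; left; exact: (component_layer cDG).
Qed.

Hypothesis hreg : Fitting_regular G.

Lemma centraliser_sub_proFitting : C `<=` F.
Proof.
apply: contrapT => nCF.
have ntH : ~ trivial_group H.
  move=> triv; apply: nCF => c Cc; apply: NC_sub_F; split=> //.
  apply/(@quot_pi1 _ NS).
  by have : [set: H] (\pi_H c) by []; rewrite triv.
apply: (hreg (N := NS) cN ntH).
have g1 : group_closed [in [set 1 : H]].
  apply: gset_intro => [//|x y -> ->|x ->]; first by rewrite /= mulg1.
  by rewrite /= invg1.
have c1 : closed [set 1 : H] by exact: closed1.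
apply/seteqP; split; last by move=> _ ->; exact: (gset1 (@topgen_gset H _)).
apply: topgen_min => // x [Lx|Fx].
  suff : layer H `<=` [set 1] by exact.
  by apply: topgen_min => // y [P /quotient_no_component].
suff : proFitting H `<=` [set 1] by exact.
apply: topgen_min => // y [P [sP [p [pp ppP]]] Py].
exact: (quotient_pro_p_trivial pp sP ppP).
Qed.

End Centraliser.

Theorem theorem4p4p1 (G : topGroupType) (hG : profinite G) (hreg : Fitting_regular G) :
  centraliser (gen_proFitting G) = centre (proFitting G).
Proof.
apply/seteqP; split; last exact: centre_proFitting_sub.
move=> x Cx; split; first exact: centraliser_sub_proFitting.
by move=> a Fa; apply: Cx; apply: topgen_sub; right.
Qed.
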